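(* Let $(\Omega,\mu)$ be an atomless finite measure space and let $p(\cdot)$ be an exponent on $\Omega$. Let $i:L^\infty(\mu)\hookrightarrow L^{p(\cdot)}(\mu)$ be the inclusion. The following are equivalent: (1) $\int_0^{\mu(\Omega)} a^{p^*(x)}\,dx<\infty$ for every $a>1$. (2) Every sequence $(E_n)_n$ of measurable sets with $\chi_{E_n}\to 0$ $\mu$-a.e. satisfies $\|\chi_{E_n}\|_{p(\cdot)}\to 0$. (3) $i$ is $L$-weakly compact. (4) $i$ is $M$-weakly compact. (5) $i$ is weakly compact. (6) $i$ is strictly singular. (7) $i$ is disjointly strictly singular.
   Context: An exponent on $\Omega$ is a real measurable function $p$ with $1\le p(t)<\infty$ (possibly unbounded). The variable Lebesgue space $L^{p(\cdot)}(\mu)$ is the space of all (classes of) real measurable $f$ on $\Omega$ such that $\rho_{p(\cdot)}(f/r)<\infty$ for some $r>0$, where $\rho_{p(\cdot)}(f)=\int_\Omega |f(t)|^{p(t)}d\mu$, with the Luxemburg norm $\|f\|_{p(\cdot)}=\inf\{r>0:\rho_{p(\cdot)}(f/r)\le 1\}$. On a finite measure space $L^\infty(\mu)\subset L^{p(\cdot)}(\mu)$ with continuous inclusion. For measurable $f$ on $\Omega$, the distribution function is $\mu_f(s)=\mu(\{t\in\Omega:|f(t)|>s\})$ and the decreasing rearrangement is $f^*(x)=\inf\{s\in[0,\infty):\mu_f(s)\le x\}$ for $x\in[0,\mu(\Omega))$. ''Isomorphism'' means isomorphism onto the image. An operator $T:E\to F$ between Banach spaces is strictly singular if there is no infinite-dimensional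 closed subspace $E_1$ of $E$ such that $T|_{E_1}$ is an isomorphism. If $E$ is a Banach lattice, $T$ is disjointly strictly singular (DSS) if there is no normalized pairwise disjoint sequence $(f_n)$ in $E$ such that the restriction of $T$ to the closed linear span $[f_n]$ is an isomorphism, and $T$ is $M$-weakly compact if $\lim_n\|Tf_n\|_F=0$ for every norm bounded disjoint sequence $(f_n)$ in $E$. If $E,F$ are Banach function lattices on $(\Omega,\mu)$, $T$ is $L$-weakly compact if $\lim_{n\to\infty}\sup_{f\in B_E}\|(Tf)\chi_{A_n}\|_F=0$ for every sequence $(A_n)$ of measurable sets with $\chi_{A_n}\to 0$ $\mu$-a.e., where $B_E$ is the unit ball of $E$. *)

(* Defs.v *)
From HB Require Import structures.
From mathcomp Require Import all_boot all_order all_algebra.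
From mathcomp Require Import all_classical all_reals all_analysis.
From mathcomp Require Import measurable_realfun ess_sup_inf.

Set Implicit Arguments.
Unset Strict Implicit.
Unset Printing Implicit Defensive.

Import Order.TTheory GRing.Theory Num.Theory.
Import numFieldNormedType.Exports.

Local Open Scope classical_set_scope.
Local Open Scope ring_scope.

Section operators.
Context {R : realType}.
Implicit Types E F : normedModType R.

Definition is_subspace E (V : set E) : Prop :=
  V 0 /\ forall (a : R) (x y : E), V x -> V y -> V (a *: x + y).

Definition finite_dimensional E (V : set E) : Prop :=
  exists (n : nat) (e : 'I_n -> E), (forall i, V (e i)) /\
    forall x, V x -> exists a : 'I_n -> R, x = \sum_(i < n) a i *: e i.

(* the restriction of [f] to [V] is an isomorphism onto its image; for a
   linear [f] and a subspace [V], the inverse [g] is automatically linear on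
   [f @` V] *)
Definition iso_onto_image E F (f : {linear E -> F}) (V : set E) : Prop :=
  {within V, continuous f} /\
  exists2 g : F -> E,
    (forall x, V x -> g (f x) = x) & {within f @` V, continuous g}.

Definition strictly_singular E F (f : {linear E -> F}) : Prop :=
  ~ exists V : set E, [/\ is_subspace V, closed V,
      ~ finite_dimensional V & iso_onto_image f V].

Definition unit_ball E : set E := [set x | `|x| <= 1].

Definition closed_span E (e : nat -> E) : set E :=
  closure [set x | exists (n : nat) (a : nat -> R),
                   x = \sum_(k < n) a k *: e k].

Definition dual E : Type := {phi : {linear E -> R^o} | continuous phi}.

(* [E] with its weak topology, the coarsest one that makes every element of
   the topological dual continuous *)
Definition weak E : Type :=
  sup_topology (fun phi : dual E =>
    Topological.on (initial_topology (sval phi : E -> R^o))).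

HB.instance Definition _ E := Topological.on (weak E).

Lemma cvg_weak E (G : set_system E) (x : E) : Filter G ->
  (G --> (x : weak E)) <->
  forall phi : dual E, sval phi y @[y --> G] --> sval phi x.
Proof.
move=> FG; rewrite cvg_sup; split=> Gx phi A nA.
  by apply: (Gx phi); exact: (@initial_continuous _ _ (sval phi) x A).
move: nA; rewrite (@nbhsE (initial_topology (sval phi : E -> R^o)))/=.
move=> [_ [[C oC <-] Cx] CA]; apply: filterS CA _.
by apply: (Gx phi C); exact: open_nbhs_nbhs.
Qed.

Definition weakly_compact E F (f : {linear E -> F}) : Prop :=
  precompact (f @` @unit_ball E : set (weak F)).

End operators.
Arguments unit_ball {R} E.
Arguments dual {R} E.
Arguments weak {R} E.

Section function_lattice.
Context d (T : measurableType d) (R : realType).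
Variable mu : {measure set T -> \bar R}.

(* A normed function lattice on [(T, mu)], presented by the functions whose
   classes belong to it and by the norm of these classes, as a function of a
   representative: [fl_solid] makes both invariant under equality a.e. The space
   of classes itself is [fl_space] below. *)
Record function_lattice := FunctionLattice {
  fl_mem : set (T -> R);
  fl_norm : (T -> R) -> R;
  fl_measurable : forall f, fl_mem f -> measurable_fun [set: T] f;
  fl_mem0 : fl_mem 0;
  fl_memP : forall (a : R) (f g : T -> R), fl_mem f -> fl_mem g -> fl_mem (a *: f + g);
  fl_normD : forall f g, fl_mem f -> fl_mem g ->
    fl_norm (f + g) <= fl_norm f + fl_norm g;
  fl_normZ : forall (a : R) f, fl_mem f -> fl_norm (a *: f) = `|a| * fl_norm f;
  fl_norm_eq0 : forall f : T -> R, fl_mem f -> fl_norm f = 0 ->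
    {ae mu, forall t, f t = 0};
  fl_solid : forall f g : T -> R, measurable_fun [set: T] f -> fl_mem g ->
    {ae mu, forall t, `|f t| <= `|g t|} ->
    fl_mem f /\ fl_norm f <= fl_norm g
}.

Variable X : function_lattice.

Definition fl_pred : {pred T -> R} := [pred f | `[< fl_mem X f >]].

Lemma fl_predP f : reflect (fl_mem X f) (f \in fl_pred).
Proof. exact: asboolP. Qed.

Lemma fl_submod_closed : submod_closed fl_pred.
Proof.
split; first exact/fl_predP/fl_mem0.
by move=> a f g /fl_predP fX /fl_predP gX; exact/fl_predP/fl_memP.
Qed.

HB.instance Definition _ :=
  GRing.isSubmodClosed.Build _ _ fl_pred fl_submod_closed.

Record fl_fun := FlFun { fl_val :> T -> R ; fl_valP : fl_val \in fl_pred }.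

HB.instance Definition _ := [isSub for fl_val].
HB.instance Definition _ := [Choice of fl_fun by <:].
HB.instance Definition _ := [SubChoice_isSubLmodule of fl_fun by <:].

Lemma fl_funP (f : fl_fun) : fl_mem X f.
Proof. exact/fl_predP/fl_valP. Qed.

Definition fl_ae_eq (f g : fl_fun) : bool :=
  `[< {ae mu, forall t, f t = g t} >].

Lemma fl_ae_eq_equiv : equiv_class_of fl_ae_eq.
Proof.
split.
- by move=> f; apply/asboolP; exact: nearW.
- by move=> f g; apply/asboolP/asboolP; apply: filterS => t ->.
- move=> g f h /asboolP fg /asboolP gh; apply/asboolP.
  by apply: filterS2 fg gh => t -> ->.
Qed.

Canonical fl_ae_eq_canonical := EquivRelPack fl_ae_eq_equiv.

Local Open Scope quotient_scope.

Definition fl_space : Type := {eq_quot fl_ae_eq}.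

HB.instance Definition _ := Choice.on fl_space.
HB.instance Definition _ := EqQuotient.on fl_space.

Definition fl_repr (u : fl_space) : T -> R := repr u.

Definition fl_class (f : fl_fun) : fl_space := \pi_fl_space f.

Lemma eq_fl_class (f g : fl_fun) :
  {ae mu, forall t, f t = g t} <-> fl_class f = fl_class g.
Proof.
split=> [fg|/eqP]; first by apply/eqP; rewrite eqmodE; exact/asboolP.
by rewrite eqmodE => /asboolP.
Qed.

Lemma fl_classK (f : fl_fun) : {ae mu, forall t, fl_repr (fl_class f) t = f t}.
Proof. by apply/eq_fl_class; rewrite /fl_class /= reprK. Qed.

Lemma fl_reprK (u : fl_space) : fl_class (repr u) = u.
Proof. by rewrite /fl_class reprK. Qed.

Definition fl_zero : fl_space := fl_class 0.
Definition fl_opp (u : fl_space) : fl_space := fl_class (- repr u).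
Definition fl_add (u v : fl_space) : fl_space := fl_class (repr u + repr v).
Definition fl_scale (a : R) (u : fl_space) : fl_space := fl_class (a *: repr u).

Lemma fl_oppE f : fl_opp (fl_class f) = fl_class (- f).
Proof.
apply/eq_fl_class; apply: filterS (fl_classK f) => t ft.
by congr (- _); exact: ft.
Qed.

Lemma fl_addE f g : fl_add (fl_class f) (fl_class g) = fl_class (f + g).
Proof.
apply/eq_fl_class; apply: filterS2 (fl_classK f) (fl_classK g) => t ft gt.
by congr (_ + _); [exact: ft|exact: gt].
Qed.

Lemma fl_scaleE a f : fl_scale a (fl_class f) = fl_class (a *: f).
Proof.
apply/eq_fl_class; apply: filterS (fl_classK f) => t ft.
by congr (_ *: _); exact: ft.
Qed.

Lemma fl_addA : associative fl_add.
Proof.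
move=> u v w; rewrite -[u]fl_reprK -[v]fl_reprK -[w]fl_reprK.
by rewrite !fl_addE addrA.
Qed.

Lemma fl_addC : commutative fl_add.
Proof. by move=> u v; rewrite /fl_add addrC. Qed.

Lemma fl_add0 : left_id fl_zero fl_add.
Proof. by move=> u; rewrite -[u]fl_reprK fl_addE add0r. Qed.

Lemma fl_addN : left_inverse fl_zero fl_opp fl_add.
Proof. by move=> u; rewrite -[u]fl_reprK fl_oppE fl_addE addNr. Qed.

HB.instance Definition _ :=
  GRing.isZmodule.Build fl_space fl_addA fl_addC fl_add0 fl_addN.

Lemma fl_scaleA a b u : fl_scale a (fl_scale b u) = fl_scale (a * b) u.
Proof. by rewrite -[u]fl_reprK !fl_scaleE scalerA. Qed.

Lemma fl_scale1 : left_id 1 fl_scale.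
Proof. by move=> u; rewrite -[u]fl_reprK fl_scaleE scale1r. Qed.

Lemma fl_scaleDr : right_distributive fl_scale +%R.
Proof.
move=> a u v; rewrite -[u]fl_reprK -[v]fl_reprK.
by rewrite [in LHS]/GRing.add/= [RHS]/GRing.add/= fl_addE !fl_scaleE fl_addE
  scalerDr.
Qed.

Lemma fl_scaleDl u : {morph fl_scale^~ u : a b / a + b}.
Proof.
move=> a b; rewrite -[u]fl_reprK [RHS]/GRing.add/= !fl_scaleE fl_addE.
by rewrite scalerDl.
Qed.

HB.instance Definition _ := GRing.Zmodule_isLmodule.Build R fl_space
  fl_scaleA fl_scale1 fl_scaleDr fl_scaleDl.

Lemma fl_class_is_linear : linear fl_class.
Proof.
move=> a f g; rewrite [in RHS]/GRing.scale/= [RHS]/GRing.add/=.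
by rewrite fl_scaleE fl_addE.
Qed.

HB.instance Definition _ :=
  GRing.isLinear.Build R fl_fun fl_space *:%R fl_class fl_class_is_linear.

Definition fl_space_norm (u : fl_space) : R := fl_norm X (fl_repr u).

Lemma fl_space_normE f : fl_space_norm (fl_class f) = fl_norm X f.
Proof.
apply/eqP; rewrite eq_le; apply/andP; split.
- apply: (fl_solid (fl_measurable (fl_funP _)) (fl_funP f) _).2.
  by apply: filterS (fl_classK f) => t; rewrite /fl_repr => ->.
- apply: (fl_solid (fl_measurable (fl_funP f)) (fl_funP (repr _)) _).2.
  by apply: filterS (fl_classK f) => t; rewrite /fl_repr => ->.
Qed.

Lemma fl_space_normD u v :
  fl_space_norm (u + v) <= fl_space_norm u + fl_space_norm v.
Proof.
rewrite -[u]fl_reprK -[v]fl_reprK -linearD !fl_space_normE.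
by apply: fl_normD; exact: fl_funP.
Qed.

Lemma fl_space_normZ (a : R) u : fl_space_norm (a *: u) = `|a| * fl_space_norm u.
Proof.
rewrite -[u]fl_reprK -linearZ !fl_space_normE.
by apply: fl_normZ; exact: fl_funP.
Qed.

Lemma fl_space_norm_eq0 u : fl_space_norm u = 0 -> u = 0.
Proof.
rewrite -[u]fl_reprK fl_space_normE => /(fl_norm_eq0 (fl_funP _)) u0.
by apply/eq_fl_class; exact: u0.
Qed.

HB.instance Definition _ := @Lmodule_isNormed.Build R fl_space
  fl_space_norm fl_space_normD fl_space_normZ fl_space_norm_eq0.

Lemma fl_norm_class f : `|fl_class f| = fl_norm X f.
Proof. exact: fl_space_normE. Qed.

End function_lattice.

Coercion fl_repr : fl_space >-> Funclass.

Section inclusion.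
Context d (T : measurableType d) (R : realType).
Variable mu : {measure set T -> \bar R}.
Variables (X Y : function_lattice mu) (XY : fl_mem X `<=` fl_mem Y).

Definition fl_incl_fun (f : fl_fun X) : fl_fun Y :=
  FlFun (introT (fl_predP Y f) (XY (fl_funP f))).

(* the inclusion sends the class of [f] in [X] to the class of [f] in [Y] *)
Definition fl_incl (u : fl_space X) : fl_space Y :=
  fl_class (fl_incl_fun (repr u)).

Lemma fl_inclE (u : fl_space X) : {ae mu, forall t, fl_incl u t = u t}.
Proof. exact: fl_classK. Qed.

Lemma fl_incl_is_linear : linear fl_incl.
Proof.
move=> a u v; rewrite /fl_incl -linearP; apply/eq_fl_class.
pose w : fl_fun X := a *: (repr u : fl_fun X) + (repr v : fl_fun X).
have wE : fl_class w = a *: u + v by rewrite linearP/= !fl_reprK.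
by have := fl_classK w; rewrite wE; apply: filterS => t; rewrite /fl_repr => ->.
Qed.

HB.instance Definition _ :=
  GRing.isLinear.Build R (fl_space X) (fl_space Y) *:%R fl_incl
    fl_incl_is_linear.

End inclusion.

Section lattice_operators.
Context d (T : measurableType d) (R : realType).
Variable mu : {measure set T -> \bar R}.
Implicit Types (X Y : function_lattice mu) (F : normedModType R).

(* [|u| /\ |v| = 0] in the lattice *)
Definition fl_disjoint X (u v : fl_space X) : Prop :=
  {ae mu, forall t, Num.min `|u t| `|v t| = 0}.

Definition pairwise_disjoint X (u : nat -> fl_space X) : Prop :=
  forall m n, m != n -> fl_disjoint (u m) (u n).

Definition disjointly_strictly_singular X F (f : {linear fl_space X -> F}) :
  Prop :=
  ~ exists u : nat -> fl_space X, [/\ forall n, `|u n| = 1,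
      pairwise_disjoint u & iso_onto_image f (closed_span u)].

Definition M_weakly_compact X F (f : {linear fl_space X -> F}) : Prop :=
  forall u : nat -> fl_space X,
    (exists M : R, forall n, `|u n| <= M) -> pairwise_disjoint u ->
    `|f (u n)| @[n --> \oo] --> (0 : R).

Definition L_weakly_compact X Y (f : {linear fl_space X -> fl_space Y}) :
  Prop :=
  forall A : nat -> set T, (forall n, measurable (A n)) ->
    {ae mu, forall t, (\1_(A n) t : R) @[n --> \oo] --> (0 : R)} ->
    ereal_sup [set (fl_norm Y (fun t => fl_repr (f u) t * \1_(A n) t))%:E
              | u in unit_ball (fl_space X)] @[n --> \oo] --> 0%E.

End lattice_operators.

Section measure_notions.
Context d (T : measurableType d) (R : realType).
Implicit Type mu : {measure set T -> \bar R}.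

Definition atomless mu : Prop :=
  forall A, measurable A -> (0 < mu A)%E ->
    exists B, [/\ measurable B, B `<=` A, (0 < mu B)%E & (mu B < mu A)%E].

Record exponent := Exponent {
  exponent_fun :> T -> R;
  exponent_measurable : measurable_fun [set: T] exponent_fun;
  exponent_ge1 : forall t, 1 <= exponent_fun t
}.

Definition distribution_function mu (f : T -> R) (s : R) : \bar R :=
  mu [set t | s < `|f t|].

(* [ereal_inf set0 = +oo], which happens only for x = 0 ([f] essentially unbounded) when
   [mu] is finite and x >= 0 *)
Definition rearrangement mu (f : T -> R) (x : R) : \bar R :=
  ereal_inf [set s%:E |
    s in [set s | 0 <= s /\ (distribution_function mu f s <= x%:E)%E]].

Definition modular mu (p : exponent) (f : T -> R) : \bar R :=
  (\int[mu]_t ((`|f t| `^ p t)%R)%:E)%E.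

(* [inf set0 = 0], which happens only outside of [variable_Lebesgue_mem mu p] *)
Definition luxemburg_norm mu (p : exponent) (f : T -> R) : R :=
  inf [set r | 0 < r /\ (modular mu p (fun t => f t / r)%R <= 1)%E].

Definition variable_Lebesgue_mem mu (p : exponent) : set (T -> R) :=
  [set f : T -> R | measurable_fun [set: T] f /\
    exists2 r : R, 0 < r & (modular mu p (fun t => f t / r)%R < +oo)%E].

End measure_notions.

Section variable_Lebesgue.
Context d (T : measurableType d) (R : realType).
Variables (mu : {measure set T -> \bar R}) (p : exponent T R).
Implicit Types (f g : T -> R) (a b r : R).

Local Notation rho := (modular mu p).
Local Notation mem := (variable_Lebesgue_mem mu p).
Local Notation norm := (luxemburg_norm mu p).

Let p_gt0 t : 0 < p t.
Proof. exact: lt_le_trans (exponent_ge1 p t). Qed.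

Lemma powR_abs_convex (q a x y : R) : 1 <= q -> 0 <= a -> a <= 1 ->
  `|a * x + (1 - a) * y| `^ q <= a * `|x| `^ q + (1 - a) * `|y| `^ q.
Proof.
move=> q1 a0 a1.
have b0 : 0 <= 1 - a by rewrite subr_ge0.
rewrite (@le_trans _ _ ((a * `|x| + (1 - a) * `|y|) `^ q))//.
  apply: ge0_ler_powR; rewrite ?nnegrE ?addr_ge0 ?mulr_ge0 ?(le_trans _ q1)//.
  by rewrite (le_trans (ler_normD _ _))// !normrM (ger0_norm a0) (ger0_norm b0).
by apply: (convex_powR q1 (Itv01 a0 a1)); rewrite inE/= in_itv/= normr_ge0.
Qed.

Lemma measurable_modular f : measurable_fun [set: T] f ->
  measurable_fun [set: T] ((fun t => (`|f t| `^ p t)%:E) : T -> \bar R).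
Proof.
move=> mf; apply/measurable_EFinP.
rewrite (_ : (fun t => _) =
  (fun t => if `|f t| == 0 then 0 else expR (p t * ln `|f t|))); last first.
  by apply/funext => t; rewrite /powR (gt_eqF (p_gt0 t)).
have mnf : measurable_fun [set: T] (fun t => `|f t|) by exact: measurableT_comp.
apply: measurable_fun_ifT.
- exact: measurable_fun_eqr.
- exact: measurable_cst.
- apply: measurableT_comp => //; apply: measurable_funM.
    exact: exponent_measurable.
  exact: (measurableT_comp (@measurable_ln R)).
Qed.

Lemma le_modular f g : measurable_fun [set: T] f -> measurable_fun [set: T] g ->
  {ae mu, forall t, `|f t| <= `|g t|} -> (rho f <= rho g)%E.
Proof.
move=> mf mg fg; apply: ae_ge0_le_integral => //.
- exact: measurable_modular.
- exact: measurable_modular.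
- move: fg; apply: filterS => t ft _.
  by rewrite lee_fin ge0_ler_powR ?nnegrE// ltW.
Qed.

Lemma modular_ge0 f : (0 <= rho f)%E.
Proof. by apply: integral_ge0 => t _; rewrite lee_fin powR_ge0. Qed.

Lemma modular_convex a f g : 0 <= a -> a <= 1 ->
  measurable_fun [set: T] f -> measurable_fun [set: T] g ->
  (rho (fun t => a * f t + (1 - a) * g t)%R
     <= a%:E * rho f + (1 - a)%:E * rho g)%E.
Proof.
move=> a0 a1 mf mg.
have b0 : 0 <= 1 - a by rewrite subr_ge0.
have pge0 h t : (0 <= (`|h t| `^ p t)%:E)%E by rewrite lee_fin powR_ge0.
rewrite -!ge0_integralZl_EFin//; try exact: measurable_modular.
rewrite -ge0_integralD//; last 4 first.
- by move=> t _; rewrite mule_ge0// lee_fin.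
- by apply: measurable_funeM; exact: measurable_modular.
- by move=> t _; rewrite mule_ge0// lee_fin.
- by apply: measurable_funeM; exact: measurable_modular.
apply: ge0_le_integral => //.
- apply: measurable_modular.
  by apply: measurable_funD; apply: measurable_funM.
- by apply: emeasurable_funD; apply: measurable_funeM; exact: measurable_modular.
- by move=> t _; rewrite -!EFinM -EFinD lee_fin powR_abs_convex// exponent_ge1.
Qed.

Lemma modular0 : rho (cst 0) = 0%E.
Proof.
rewrite /modular; under eq_integral do rewrite /= normr0 powR0 ?gt_eqF//.
exact: integral0.
Qed.

Lemma modularZ_le a f : 0 <= a -> a <= 1 -> measurable_fun [set: T] f ->
  (rho (fun t => a * f t)%R <= a%:E * rho f)%E.
Proof.
move=> a0 a1 mf; have := modular_convex a0 a1 mf (measurable_cst (0 : R)).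
rewrite -/(cst 0) modular0 mule0 adde0; under eq_fun do rewrite mulr0 addr0.
exact.
Qed.

Let measurable_div f r : measurable_fun [set: T] f ->
  measurable_fun [set: T] (fun t => f t / r).
Proof. by move=> mf; apply: measurable_funM. Qed.

Lemma variable_Lebesgue_memP f : mem f -> exists r : R,
  0 < r /\ (rho (fun t => f t / r)%R <= 1)%E.
Proof.
move=> [mf [r r0 fr]].
have fin : rho (fun t => f t / r) \is a fin_num.
  by rewrite ge0_fin_numE// modular_ge0.
pose k := Num.max 1 (fine (rho (fun t => f t / r))).
have k1 : 1 <= k by rewrite le_max lexx.
have k0 : 0 < k by exact: lt_le_trans k1.
exists (r * k); split; first exact: mulr_gt0.
rewrite (_ : (fun t => _) = (fun t => k^-1 * (f t / r))); last first.
  by apply/funext => t; rewrite invfM mulrA mulrC.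
apply: le_trans (modularZ_le _ _ (measurable_div _ mf)) _.
- by rewrite invr_ge0 ltW.
- by rewrite invf_le1.
- rewrite -[X in (_ * X)%E]fineK// -EFinM lee_fin mulrC ler_pdivrMr// mul1r.
  by rewrite le_max lexx orbT.
Qed.

Lemma variable_Lebesgue_mem0 : mem 0.
Proof.
split; first exact: measurable_cst.
exists 1 => //; rewrite (_ : (fun t => _) = cst 0) ?modular0//.
by apply/funext => t; rewrite mul0r.
Qed.

Lemma variable_Lebesgue_memS f g : measurable_fun [set: T] f -> mem g ->
  {ae mu, forall t, `|f t| <= `|g t|} -> mem f.
Proof.
move=> mf [mg [r r0 gr]] fg; split=> //; exists r => //.
apply: le_lt_trans gr; apply: le_modular; try exact: measurable_div.
by apply: filterS fg => t; rewrite !normrM => ft; exact: ler_wpM2r.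
Qed.

Let conv_div f g r s : 0 < r -> 0 < s ->
  (fun t => (f t + g t) / (r + s)) =
  (fun t => (r / (r + s)) * (f t / r) + (1 - r / (r + s)) * (g t / s)).
Proof.
move=> r0 s0; apply/funext => t; have rs : r + s != 0 by rewrite gt_eqF ?addr_gt0.
have -> : 1 - r / (r + s) = s / (r + s).
  by rewrite -{1}(divff rs) -mulrBl addrAC subrr add0r.
rewrite mulrDl; congr (_ + _).
  by rewrite mulrACA [r * f t]mulrC -mulrA; congr (_ * _);
    rewrite mulrCA divff ?gt_eqF// mulr1.
by rewrite mulrACA [s * g t]mulrC -mulrA; congr (_ * _);
  rewrite mulrCA divff ?gt_eqF// mulr1.
Qed.

Let div_itv r s : 0 < r -> 0 < s -> 0 <= r / (r + s) /\ r / (r + s) <= 1.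
Proof.
move=> r0 s0; have rs : 0 < r + s by rewrite addr_gt0.
split; first by rewrite divr_ge0// ltW.
by rewrite ler_pdivrMr// mul1r lerDl ltW.
Qed.

Lemma variable_Lebesgue_memD f g : mem f -> mem g -> mem (f + g).
Proof.
move=> [mf [r r0 fr]] [mg [s s0 gs]]; split; first exact: measurable_funD.
exists (r + s); first by rewrite addr_gt0.
rewrite (conv_div f g r0 s0); have [a0 a1] := div_itv r0 s0.
apply: le_lt_trans (modular_convex a0 a1 (measurable_div _ mf)
  (measurable_div _ mg)) _.
by rewrite lte_add_pinfty// lte_mul_pinfty// lee_fin subr_ge0.
Qed.

Lemma variable_Lebesgue_memZ a f : mem f -> mem (a *: f).
Proof.
move=> [mf [r r0 fr]]; split; first exact: measurable_funM.
have k0 : 0 < `|a| + 1 by rewrite ltr_wpDl.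
exists ((`|a| + 1) * r); first by rewrite mulr_gt0.
apply: le_lt_trans fr; apply: le_modular; try exact: measurable_div.
  by apply: measurable_div; exact: measurable_funM.
apply: nearW => t; rewrite -[(a *: f) t]/(a * f t) invfM mulrACA normrM.
rewrite ler_piMl// normrM normfV [X in _ / X]ger0_norm ?(ltW k0)//.
by rewrite ler_pdivrMr// mul1r lerDl.
Qed.

Let has_lbound_norm f :
  has_lbound [set r | 0 < r /\ (rho (fun t => f t / r)%R <= 1)%E].
Proof. by exists 0 => r [/ltW]. Qed.

Lemma luxemburg_norm_ge0 f : 0 <= norm f.
Proof.
rewrite /luxemburg_norm; have [->|/set0P f0] :=
  eqVneq [set r | 0 < r /\ (rho (fun t => f t / r)%R <= 1)%E] set0.
  by rewrite inf0.
by apply: lb_le_inf => // r [/ltW].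
Qed.

Lemma luxemburg_norm_le f r : 0 < r -> (rho (fun t => f t / r)%R <= 1)%E ->
  norm f <= r.
Proof. by move=> r0 fr; apply: ge_inf. Qed.

Lemma luxemburg_normS f g : measurable_fun [set: T] f -> mem g ->
  {ae mu, forall t, `|f t| <= `|g t|} -> norm f <= norm g.
Proof.
move=> mf Lg fg; apply: lb_le_inf; first exact: variable_Lebesgue_memP.
move=> r [r0 gr]; apply: luxemburg_norm_le => //; apply: le_trans gr.
apply: le_modular; try exact: measurable_div; first exact: measurable_div Lg.1.
by apply: filterS fg => t; rewrite !normrM => ft; exact: ler_wpM2r.
Qed.

Lemma luxemburg_normD f g : mem f -> mem g -> norm (f + g) <= norm f + norm g.
Proof.
move=> Lf Lg; rewrite -lerBlDr; apply: lb_le_inf.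
  exact: variable_Lebesgue_memP.
move=> r [r0 fr]; rewrite lerBlDr -lerBlDl; apply: lb_le_inf.
  exact: variable_Lebesgue_memP.
move=> s [s0 gs]; rewrite lerBlDl; apply: luxemburg_norm_le.
  by rewrite addr_gt0.
rewrite (conv_div f g r0 s0); have [a0 a1] := div_itv r0 s0.
apply: le_trans (modular_convex a0 a1 (measurable_div _ Lf.1)
  (measurable_div _ Lg.1)) _.
rewrite [leRHS](_ : _ = (r / (r + s))%:E * 1 + (1 - r / (r + s))%:E * 1)%E.
  by apply: leeD; apply: lee_wpmul2l; rewrite // lee_fin subr_ge0.
by rewrite !mule1 -EFinD addrC subrK.
Qed.

Lemma luxemburg_norm0 : norm 0 = 0.
Proof.
apply/eqP; rewrite eq_le luxemburg_norm_ge0 andbT.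
apply/ler_addgt0Pr => e e0; rewrite add0r; apply: luxemburg_norm_le => //.
rewrite (_ : (fun t => _) = cst 0) ?modular0//.
by apply/funext => t; rewrite mul0r.
Qed.

Lemma luxemburg_normZ a f : mem f -> norm (a *: f) = `|a| * norm f.
Proof.
have le b g : b != 0 -> mem g -> norm (b *: g) <= `|b| * norm g.
  move=> b0 Lg; have b_gt0 : 0 < `|b| by rewrite normr_gt0.
  rewrite -ler_pdivrMl//; apply: lb_le_inf; first exact: variable_Lebesgue_memP.
  move=> r [r0 gr]; rewrite ler_pdivrMl//.
  apply: luxemburg_norm_le; first by rewrite mulr_gt0.
  apply: le_trans gr; apply: le_modular; last first.
  - apply: nearW => t; rewrite -[(b *: g) t]/(b * g t) invfM mulrACA normrM.
    by rewrite normrM normfV normr_id divff ?gt_eqF// mul1r.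
  - by apply: measurable_div; exact: Lg.1.
  - by apply: measurable_div; apply: measurable_funM => //; exact: Lg.1.
move=> Lf; have [->|a0] := eqVneq a 0.
  by rewrite scale0r luxemburg_norm0 normr0 mul0r.
apply/eqP; rewrite eq_le le//=.
have := le _ _ (invr_neq0 a0) (variable_Lebesgue_memZ a Lf).
rewrite scalerA mulVf// scale1r normfV => fle.
by rewrite -ler_pdivlMl ?normr_gt0.
Qed.

Lemma luxemburg_norm_eq0 f : mem f -> norm f = 0 -> {ae mu, forall t, f t = 0}.
Proof.
move=> Lf f0; have mf := Lf.1.
have rhof : rho f = 0%E.
  apply/eqP; rewrite eq_le modular_ge0 andbT.
  apply/lee_addgt0Pr => e e0; rewrite add0e.
  have m0 : 0 < Num.min e 1 by rewrite lt_min e0 ltr01.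
  have [|r [r0 fr]] := @inf_adherent _
      [set r | 0 < r /\ (rho (fun t => f t / r)%R <= 1)%E] _ m0.
    by split; [exact: variable_Lebesgue_memP|exact: has_lbound_norm].
  rewrite -/(norm f) f0 add0r lt_min => /andP[re r1].
  rewrite (_ : f = (fun t => r * (f t / r))); last first.
    by apply/funext => t; rewrite mulrC divfK// gt_eqF.
  apply: le_trans (modularZ_le (ltW r0) (ltW r1) (measurable_div _ mf)) _.
  apply: (@le_trans _ _ r%:E); last by rewrite lee_fin ltW.
  by rewrite -[leRHS]mule1; apply: lee_wpmul2l => //; rewrite lee_fin ltW.
have /ae_eq_integral_abs : (\int[mu]_t `|(`|f t| `^ p t)%:E| = 0)%E.
  rewrite -rhof; apply: eq_integral => t _.
  by rewrite gee0_abs// lee_fin powR_ge0.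
move=> /(_ measurableT (measurable_modular mf)).
by apply: filterS => t /(_ I) [] /powR_eq0_eq0/normr0_eq0.
Qed.

Lemma variable_Lebesgue_linear a f g : mem f -> mem g -> mem (a *: f + g).
Proof. by move=> Lf Lg; exact/variable_Lebesgue_memD/Lg/variable_Lebesgue_memZ. Qed.

Definition variable_Lebesgue : function_lattice mu :=
  @FunctionLattice _ T R mu mem norm
    (fun f => @proj1 _ _) variable_Lebesgue_mem0 variable_Lebesgue_linear
    luxemburg_normD luxemburg_normZ luxemburg_norm_eq0
    (fun f g mf Lg fg => conj (variable_Lebesgue_memS mf Lg fg)
                              (luxemburg_normS mf Lg fg)).

End variable_Lebesgue.

Section essentially_bounded.
Context d (T : measurableType d) (R : realType).
Variable mu : {measure set T -> \bar R}.
Implicit Types f g : T -> R.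

Let y1 : (1 <= +oo :> \bar R)%E := leey 1.

Definition Linfty_mem : set (T -> R) := [set f | f \in Lfun mu +oo].
Definition Linfty_norm f : R := fine ('N[mu]_+oo[EFin \o f])%E.

Lemma Linfty_measurable f : Linfty_mem f -> measurable_fun [set: T] f.
Proof. by move=> /sub_Lfun_mfun; rewrite inE. Qed.

Lemma Linfty_mem0 : Linfty_mem 0.
Proof. exact: (Lfun_submod_closed mu y1).1. Qed.

Lemma Linfty_memP (a : R) f g :
  Linfty_mem f -> Linfty_mem g -> Linfty_mem (a *: f + g).
Proof. by move=> fi gi; exact: (Lfun_submod_closed mu y1).2. Qed.

Lemma Linfty_normD f g : Linfty_mem f -> Linfty_mem g ->
  Linfty_norm (f + g) <= Linfty_norm f + Linfty_norm g.
Proof. by move=> fi gi; exact: (ler_LnormD (Lfun_Sub y1 fi) (Lfun_Sub y1 gi)). Qed.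

Lemma Linfty_normZ (a : R) f : Linfty_mem f ->
  Linfty_norm (a *: f) = `|a| * Linfty_norm f.
Proof.
move=> fi; rewrite /Linfty_norm (LnormZ (Lfun_Sub y1 fi) a).
by rewrite -(finite_norm_fine (Lfun_Sub y1 fi)).
Qed.

Lemma Linfty_norm_eq0 f : Linfty_mem f -> Linfty_norm f = 0 ->
  {ae mu, forall t, f t = 0}.
Proof.
move=> fi /(@fine_Lnormr_eq0 _ _ _ _ _ y1 (Lfun_Sub y1 fi)).
by apply: filterS => t /(_ I).
Qed.

Lemma Linfty_solid f g : measurable_fun [set: T] f -> Linfty_mem g ->
  {ae mu, forall t, `|f t| <= `|g t|} ->
  Linfty_mem f /\ Linfty_norm f <= Linfty_norm g.
Proof.
move=> mf gi fg.
have le : ('N[mu]_+oo[EFin \o f] <= 'N[mu]_+oo[EFin \o g])%E.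
  rewrite unlock; case: ifPn => // _; apply: le_ess_sup.
  by apply: filterS fg => t ft; rewrite /= lee_fin.
have glty : ('N[mu]_+oo[EFin \o g] < +oo)%E.
  by have := sub_Lfun_finLfun gi; rewrite inE.
have flty := le_lt_trans le glty.
split; last by apply: fine_le => //; rewrite ge0_fin_numE// Lnorm_ge0.
by rewrite /Linfty_mem/= inE; apply/andP; split; rewrite inE.
Qed.

Definition Linfty : function_lattice mu :=
  FunctionLattice Linfty_measurable Linfty_mem0 Linfty_memP
    Linfty_normD Linfty_normZ Linfty_norm_eq0 Linfty_solid.

End essentially_bounded.

Section embedding.
Context d (T : measurableType d) (R : realType).
Variables (mu : {finite_measure set T -> \bar R}) (p : exponent T R).

Lemma Linfty_sub_variable_Lebesgue :
  fl_mem (Linfty mu) `<=` fl_mem (variable_Lebesgue mu p).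
Proof.
move=> f fi; have mf := Linfty_measurable fi.
have : {ae mu, forall t, `|f t| <= Linfty_norm mu f}.
  have [/eqP mu0|muN0] := boolP (mu setT == 0%E).
    by exists [set: T]; split.
  have y1 : (1 <= +oo :> \bar R)%E by exact: leey.
  have := finite_norm_fine (Lfun_Sub y1 fi).
  rewrite -/(Linfty_norm mu f) => fE.
  have : ('N[mu]_+oo[EFin \o f] <= (Linfty_norm mu f)%:E)%E by rewrite fE.
  rewrite unlock lt0e muN0 measure_ge0/= => /ess_supP.
  by apply: filterS => t; rewrite /= lee_fin.
set M := Linfty_norm mu f => fM.
split=> //; exists (`|M| + 1); first by rewrite ltr_wpDl.
apply: (@le_lt_trans _ _ (modular mu p (cst 1))).
  apply: le_modular => //; first by apply: measurable_funM.
  apply: filterS fM => t ft; rewrite normrM normfV normr1.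
  rewrite [X in _ / X]ger0_norm ?addr_ge0// ler_pdivrMr ?ltr_wpDl// mul1r.
  by rewrite (le_trans ft)// (le_trans (ler_norm _))// lerDl.
rewrite /modular; under eq_integral do rewrite /= normr1 powR1.
by rewrite integral_cst// mul1e ltey_eq fin_num_measure.
Qed.

Definition Linfty_embedding :
    {linear fl_space (Linfty mu) -> fl_space (variable_Lebesgue mu p)} :=
  fl_incl Linfty_sub_variable_Lebesgue.

End embedding.

(* Main.v *)
Require Import Defs.
From HB Require Import structures.
From mathcomp Require Import all_boot all_order all_algebra.
From mathcomp Require Import all_classical all_reals all_analysis.
From mathcomp Require Import measurable_realfun ess_sup_inf.
From mathcomp Require Import ring lra.

(** All the properties are compared with one condition on the exponent: the
integral of [a ^ p] is finite for every [a > 1], which says that every constant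
function has finite modular ([exponentially_integrable]).

The integrability of the exponential functions of [p^*] is the same condition,
because it depends only on the decay of the measures of the sets where the
exponent exceeds an integer ([exponential_tailsP]), and [x < mu (p > s)] holds
exactly when [p^* x > s], so that [p] and [p^*] have the same level sets in
measure ([lebesgue_measure_rearrangement]).

Suppose that the condition holds. When [|x| <= 1] and [b >= 1], the inequality
[(b |x|) ^ p <= b ^ N |x| + 2 ^ -N (2 b) ^ p] holds at every point, whichever of
[p] and [N] is larger; after integration it shows that on the unit ball of L^oo
a small integral of [|x|] forces a small norm in the variable Lebesgue space
([small_integral_small_norm]). Three consequences follow.
- Indicators of sets that vanish almost everywhere in the limit tend to 0 in
  norm, which gives L-weak compactness and then M-weak compactness.
- On a subspace where the inclusion is an isomorphism, the supremum norm is
  dominated by the L^1 norm, hence by the L^2 norm. If [e_1, ..., e_n] is an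
  orthonormal family of such a subspace, then [e_1^2 + ... + e_n^2] is bounded
  by a constant independent of [n], and integrating this bounds [n]
  ([finite_dimensional_L2_dominated]). So the inclusion is strictly singular.
- The restriction to L^oo of a continuous functional of the variable Lebesgue
  space is countably additive on indicators, hence integration against an
  integrable function by the Radon-Nikodym theorem ([dual_density]). The
  inclusion is therefore continuous from the weak-star to the weak topology, and
  the image of the unit ball is weakly compact. The weak-star limit of an
  ultrafilter is again produced by Radon-Nikodym
  ([ultrafilter_weak_star_limit]).

Suppose that the condition fails for some [a]. Cutting the range of [p] at
suitable integers produces disjoint sets [E_j] on each of which [a ^ p] has a
finite integral greater than 1 ([not_exponentially_integrable_bumps]). The
indicator of [E_j] has supremum norm 1 and Luxemburg norm at least [1 / a], so
the inclusion is not M-weakly compact, and it is an isomorphism on the closed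
span of these indicators, a copy of c_0, so it is not disjointly strictly
singular. Nor is it weakly compact: the averages over [E_j] weighted by [a ^ p]
are uniformly bounded functionals whose values on the partial sums of the
indicators have different iterated limits ([weakly_precompact_double_limit]).

Finally, disjoint normalized sequences span infinite-dimensional subspaces, so
strict singularity implies its disjoint version. *)

Import Order.TTheory GRing.Theory Num.Theory.
Import numFieldNormedType.Exports.

Local Open Scope classical_set_scope.
Local Open Scope ring_scope.

Set Implicit Arguments.
Unset Strict Implicit.
Unset Printing Implicit Defensive.

(** * The modular and the Luxemburg norm *)

Section luxemburg.
Context (R : realType) (d : measure_display) (T : measurableType d).
Variables (mu : {measure set T -> \bar R}) (p : exponent T R).

Lemma exponent_gt0 t : 0 < p t.
Proof. exact: lt_le_trans ltr01 (exponent_ge1 p t). Qed.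

Lemma luxemburg_norm_ge f r : 0 < r -> variable_Lebesgue_mem mu p f ->
  (1 < modular mu p (fun t => f t / r)%R)%E -> r <= luxemburg_norm mu p f.
Proof.
move=> r0 Lf fr; apply: lb_le_inf; first exact: variable_Lebesgue_memP.
move=> s [s0 fs]; rewrite leNgt; apply/negP => sr.
move: fr; rewrite ltNge => /negP; apply; apply: le_trans fs.
apply: le_modular; try by apply: measurable_funM => //; exact: Lf.1.
apply: nearW => t; rewrite !normrM ler_wpM2l// !normfV !gtr0_norm//.
by rewrite lef_pV2 ?posrE// ltW.
Qed.

Lemma modular_le1 f r : variable_Lebesgue_mem mu p f ->
  luxemburg_norm mu p f < r -> (modular mu p (fun t => f t / r)%R <= 1)%E.
Proof.
move=> Lf fr; rewrite leNgt; apply/negP => /luxemburg_norm_ge => h.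
have r0 : 0 < r by exact: le_lt_trans (luxemburg_norm_ge0 _ _ _) fr.
by have := h r0 Lf; rewrite leNgt fr.
Qed.

(** Written with the modular of a constant function, which is the integral of
[a ^ p]. *)
Definition exponentially_integrable :=
  forall a : R, 1 < a -> (modular mu p (cst a) < +oo)%E.

(** The modular of [x / r] is at most that of [b |x|], where [b] is the maximum
of 1 and [1 / r]. Where [p <= N], [(b |x|) ^ p <= b ^ N |x|] since
[|x| ^ p <= |x|]; where [p > N], [(b |x|) ^ p <= b ^ p <= 2 ^ -N (2 b) ^ p].
The integral of the second bound is at most 1/2 for [N] large, and that of the
first is then at most 1/2 as soon as the integral of [|x|] is at most
[b ^ -N / 2]. *)
Lemma small_integral_small_norm : exponentially_integrable ->
  forall r : R, 0 < r -> exists2 e : R, 0 < e &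
    forall x : T -> R, measurable_fun [set: T] x ->
      {ae mu, forall t, `|x t| <= 1} ->
      (\int[mu]_t (`|x t|)%:E <= e%:E)%E -> luxemburg_norm mu p x <= r.
Proof.
move=> J r r0; pose b := Num.max 1 r^-1.
have b1 : 1 <= b by rewrite le_max lexx.
have b0 : 0 < b by exact: lt_le_trans b1.
have bb1 : 1 < 2 * b by lra.
have := J _ bb1; set M := modular mu p _ => My.
have M0 : (0 <= M)%E by exact: modular_ge0.
have Mfin : M \is a fin_num by rewrite ge0_fin_numE.
have fM0 : 0 <= fine M by exact: fine_ge0.
have [N NM] : exists N : nat, 2^-1 ^+ N * fine M <= 2^-1.
  pose N := (Num.truncn (2 * fine M)).+1; exists N.
  rewrite exprVn ler_pdivrMl ?exprn_gt0//.
  have : 2 * fine M < N%:R by rewrite /N; exact: truncnS_gt.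
  have : (N%:R : R) <= 2 ^+ N by rewrite -natrX ler_nat; exact: ltnW (ltn_expl _ _).
  by move: (N%:R : R) (2 ^+ N : R) => u v; lra.
have bN0 : 0 < b ^+ N by rewrite exprn_gt0.
exists (b ^- N / 2); first by rewrite divr_gt0// invr_gt0.
move=> x mx x1 ex; apply: luxemburg_norm_le => //.
have mnx : measurable_fun [set: T] (fun t => (`|x t|)%:E : \bar R).
  by apply/measurable_EFinP; exact: measurableT_comp.
apply: (@le_trans _ _
    (\int[mu]_t ((b ^+ N)%:E * (`|x t|)%:E +
       (2^-1 ^+ N)%:E * (`|cst (2 * b) t| `^ p t)%:E)))%E.
  apply: ae_ge0_le_integral => //.
  - by apply: measurable_modular; apply: measurable_funM.
  - by move=> t _; rewrite adde_ge0// mule_ge0// lee_fin ?powR_ge0 ?exprn_ge0 ?(ltW b0).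
  - apply: emeasurable_funD; apply: measurable_funeM => //.
    exact: measurable_modular.
  apply: filterS x1 => t xt _; rewrite -!EFinM -EFinD lee_fin /=.
  have pt := exponent_gt0 t; have p1 := exponent_ge1 p t.
  have xb : `|x t / r| <= `|x t| * b.
    by rewrite normrM ler_wpM2l// normfV gtr0_norm// le_max lexx orbT.
  have h : `|x t / r| `^ p t <= (`|x t| * b) `^ p t.
    by apply: ge0_ler_powR; rewrite ?nnegrE ?mulr_ge0 ?(ltW b0) ?(ltW pt).
  rewrite (le_trans h)// powRM ?(ltW b0)//.
  rewrite [X in _ <= _ + _ * X `^ _]gtr0_norm; last by lra.
  rewrite powRM ?(ltW b0)//; have [pN|Np] := leP (p t) N%:R.
    apply: (@le_trans _ _ (b ^+ N * `|x t|)); last first.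
      by rewrite lerDl !mulr_ge0 ?exprn_ge0 ?powR_ge0.
    rewrite mulrC -powR_mulrn ?(ltW b0)//; apply: ler_pM; rewrite ?powR_ge0//.
      exact: ler_powR.
    have [->|xt0] := eqVneq (x t) 0; first by rewrite normr0 powR0// gt_eqF.
    by apply: ge1r_powR => //; rewrite normr_gt0 xt0.
  apply: (@le_trans _ _ (2^-1 ^+ N * (2 `^ p t * b `^ p t))); last first.
    by rewrite lerDr mulr_ge0// exprn_ge0// ltW.
  rewrite mulrA; apply: ler_wpM2r; first exact: powR_ge0.
  apply: (@le_trans _ _ 1).
    apply: (@le_trans _ _ (1 `^ p t)); last by rewrite powR1.
    by apply: ge0_ler_powR; rewrite ?nnegrE// ltW.
  rewrite exprVn ler_pdivlMl ?exprn_gt0// mulr1 -powR_mulrn//.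
  by apply: ler_powR; [lra|exact: ltW].
rewrite ge0_integralD//; last 3 first.
- by move=> t _; rewrite mule_ge0// lee_fin exprn_ge0// ltW.
- exact: measurable_funeM.
- by apply: measurable_funeM; exact: measurable_modular.
rewrite !ge0_integralZl_EFin//; last 2 first.
- exact: measurable_modular.
- by rewrite exprn_ge0// ltW.
rewrite -/(modular mu p (cst (2 * b))) -/M -(fineK Mfin).
apply: (@le_trans _ _ ((b ^+ N)%:E * (b ^- N / 2)%:E + (2^-1 ^+ N)%:E * (fine M)%:E))%E.
  by apply: leeD => //; apply: lee_wpmul2l; rewrite // lee_fin ltW.
rewrite -!EFinM -EFinD lee_fin mulrA divff ?gt_eqF// mul1r.
by lra.
Qed.

End luxemburg.

(** * Exponential integrability and tails *)

Section exponential_tails.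
Context (R : realType) (d : measure_display) (T : measurableType d).
Variables (m : {measure set T -> \bar R}) (D : set T) (q : T -> R).
Hypotheses (mD : measurable D) (mDy : (m D < +oo)%E).
Hypotheses (mq : measurable_fun D q) (q0 : forall t, D t -> 0 <= q t).

Definition exponential_tails :=
  forall a : R, 1 < a -> exists C : R,
    forall n : nat, (m (D `&` [set t | (n%:R < q t)%R]) <= (C * a ^- n)%:E)%E.

Let measurable_tail n : measurable (D `&` [set t | n%:R < q t]).
Proof.
rewrite (_ : [set _ | _] = q @^-1` `]n%:R, +oo[); first exact: mq.
by apply/seteqP; split => t /=; rewrite in_itv/= andbT.
Qed.

Let measurable_exp (a : R) : measurable_fun D (fun t => ((a `^ q t)%R)%:E).
Proof. by apply/measurable_EFinP; exact: (measurableT_comp (measurable_powRr a)). Qed.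

(** One direction is Markov's inequality. For the other, the tail bound for the
base [2 a] makes the terms of the series [sum_n a ^ (n + 2) m (q > n)], which
dominates the integral of [a ^ q] up to a constant, decay like [2 ^ -n]. *)
Lemma exponential_tailsP :
  (forall a : R, 1 < a -> (\int[m]_(t in D) ((a `^ q t)%R)%:E < +oo)%E) <->
  exponential_tails.
Proof.
split=> [J a a1|tails a a1].
- have a0 : 0 < a by lra.
  have If : (\int[m]_(t in D) ((a `^ q t)%R)%:E)%E \is a fin_num.
    rewrite ge0_fin_numE; first exact: J.
    by apply: integral_ge0 => t _; rewrite lee_fin powR_ge0.
  exists (fine (\int[m]_(t in D) ((a `^ q t)%R)%:E)%E) => n.
  set A := D `&` _; have mA : measurable A by exact: measurable_tail.
  rewrite mulrC EFinM fineK//.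
  rewrite lee_pdivlMl ?exprn_gt0//.
  rewrite -integral_cst//.
  apply: (@le_trans _ _ (\int[m]_(t in A) ((a `^ q t)%R)%:E)%E).
    apply: ge0_le_integral => //.
    + by move=> t _; rewrite lee_fin exprn_ge0// ltW.
    + by apply: measurable_funS (measurable_exp a) => //; exact: subIsetl.
    + move=> t [Dt /= nt]; rewrite lee_fin -powR_mulrn ?(ltW a0)//.
      by apply: ler_powR; rewrite ltW.
  apply: ge0_subset_integral => //; last exact: subIsetl.
  by move=> t _; rewrite lee_fin powR_ge0.
- have a0 : 0 < a by lra.
  have a21 : 1 < 2 * a by lra.
  have [C tailC] := tails _ a21.
  pose A n := D `&` [set t | n%:R < q t].
  have t0 n t : (0 <= ((a ^+ n.+2)%R%:E * (\1_(A n) t)%:E))%E.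
    by rewrite -EFinM lee_fin mulr_ge0// exprn_ge0// ltW.
  have mt n : measurable_fun D (fun t => ((a ^+ n.+2)%R%:E * (\1_(A n) t)%:E)%E).
    apply: measurable_funeM; apply/measurable_EFinP; apply: measurable_indic.
    exact: measurable_tail.
  apply: (@le_lt_trans _ _ (\int[m]_(t in D) (a%:E +
      \sum_(n <oo) ((a ^+ n.+2)%R%:E * (\1_(A n) t)%:E)))%E).
    apply: ge0_le_integral => //.
    + by move=> t _; rewrite lee_fin powR_ge0.
    + apply: emeasurable_funD => //.
      by apply: ge0_emeasurable_sum => // n t Dt _; exact: t0.
    + move=> t Dt; have [q1|q1] := ltP (q t) 1.
        apply: (@le_trans _ _ a%:E); last first.
          by rewrite leeDl// nneseries_ge0.
        by rewrite lee_fin; apply: ler1_powR; exact: ltW.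
      have := truncn_itv (q0 Dt); move: q1; rewrite -truncn_gt0.
      case: (Num.truncn (q t)) => // n _ /andP[nq qn].
      apply: (@le_trans _ _ (\sum_(0 <= k < n.+1)
          ((a ^+ k.+2)%R%:E * (\1_(A k) t)%:E))%E); last first.
        apply: (le_trans (nneseries_lim_ge _ _)) => //.
        by rewrite leeDr// lee_fin ltW.
      rewrite big_nat_recr//= (@le_trans _ _ ((a ^+ n.+2)%R%:E * (\1_(A n) t)%:E)%E)//.
        rewrite indicE mem_set ?mule1; last first.
          by split=> //=; rewrite (lt_le_trans _ nq)// ltr_nat.
        rewrite lee_fin -powR_mulrn ?(ltW a0)//.
        by apply: ler_powR; rewrite ltW.
      by rewrite leeDr// sume_ge0.
  rewrite ge0_integralD//; last 3 first.
  + by move=> t _; rewrite lee_fin ltW.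
  + by move=> t _; exact: nneseries_ge0.
  + by apply: ge0_emeasurable_sum => // n t Dt _; exact: t0.
  rewrite integral_cst//= lte_add_pinfty// ?lte_mul_pinfty// ?lee_fin ?(ltW a0)//.
  rewrite integral_nneseries//.
  apply: (@le_lt_trans _ _ (\sum_(n <oo) (a ^+ 2 * `|C| * 2 / (2 ^ n.+1)%:R)%:E)%E).
    apply: lee_nneseries => n _; first by move=> _; exact: integral_ge0.
    rewrite ge0_integralZl_EFin ?exprn_ge0 ?(ltW a0)//; last 1 first.
      by apply/measurable_EFinP; apply: measurable_indic; exact: measurable_tail.
    rewrite integral_indic//; last exact: measurable_tail.
    rewrite (_ : A n `&` D = A n); last by rewrite setIC setIA setIid.
    apply: (@le_trans _ _ ((a ^+ n.+2)%R%:E * (`|C| * (2 * a) ^- n)%:E)%E).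
      apply: lee_wpmul2l; first by rewrite lee_fin exprn_ge0// ltW.
      apply: le_trans (tailC n) _; rewrite lee_fin ler_wpM2r ?ler_norm//.
      by rewrite invr_ge0 exprn_ge0// ltW// mulr_gt0.
    rewrite -EFinM lee_fin natrX exprMn invfM !exprS.
    have an0 : a ^+ n != 0 by rewrite expf_neq0// gt_eqF.
    have tn0 : (2 : R) ^+ n != 0 by rewrite expf_neq0.
    by rewrite le_eqVlt; apply/orP; left; apply/eqP; field; rewrite an0 tn0.
  apply: le_lt_trans (epsilon_trick0 _ _) (ltry _).
  by rewrite !mulr_ge0// ltW.
Qed.

End exponential_tails.

(** * The decreasing rearrangement *)

Section rearrangement.
Context (R : realType) (d : measure_display) (T : measurableType d).
Variables (mu : {finite_measure set T -> \bar R}) (f : T -> R).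
Hypothesis mf : measurable_fun [set: T] f.

Let measurable_level s : measurable [set t | s < `|f t|].
Proof.
have mnf : measurable_fun [set: T] (fun t => `|f t|) by exact: measurableT_comp.
rewrite (_ : [set _ | _] = [set: T] `&` (fun t => `|f t|) @^-1` `]s, +oo[).
  exact: mnf.
by rewrite setTI; apply/seteqP; split => t /=; rewrite in_itv/= andbT.
Qed.

Lemma le_distribution_function s s' : s <= s' ->
  (distribution_function mu f s' <= distribution_function mu f s)%E.
Proof.
move=> ss'; apply: le_measure; rewrite ?inE; try exact: measurable_level.
by move=> t /=; exact: le_lt_trans.
Qed.

(** Right continuity of the distribution function: the set where [s < |f|] is the
increasing union of the sets where [s + 1 / (n + 1) < |f|]. *)
Lemma distribution_function_le_right s (x : \bar R) :
  (forall s', s < s' -> (distribution_function mu f s' <= x)%E) ->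
  (distribution_function mu f s <= x)%E.
Proof.
move=> sx; pose F n := [set t | s + n.+1%:R^-1 < `|f t|].
have FE : \bigcup_n F n = [set t | s < `|f t|].
  apply/seteqP; split => [t [n _] /=|t /= st].
    by apply: lt_trans; rewrite ltrDl invr_gt0.
  have st' : 0 < `|f t| - s by rewrite subr_gt0.
  have [n _ /(_ n (leqnn _)) /= h] := near_infty_natSinv_lt (PosNum st').
  by exists n => //; rewrite /F/= addrC -ltrBrDr.
rewrite /distribution_function -FE.
have mF n : measurable (F n) by exact: measurable_level.
have : mu (F n) @[n --> \oo] --> mu (\bigcup_n F n).
  apply: nondecreasing_cvg_mu => //; first exact: bigcup_measurable.
  move=> m n mn; apply/subsetPset => t /=; apply: le_lt_trans.
  by rewrite lerD2l lef_pV2 ?posrE// ler_nat ltnS.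
move=> Fcvg; apply: cvge_le Fcvg.
by apply: nearW => n; apply: sx; rewrite ltrDl invr_gt0.
Qed.

(** The rearrangement and the distribution function form a Galois connection:
the infimum defining the former is attained, by right continuity. *)
Lemma rearrangement_le s x : 0 <= s ->
  (rearrangement mu f x <= s%:E)%E = (distribution_function mu f s <= x%:E)%E.
Proof.
move=> s0; apply/idP/idP => [rs|fs]; last first.
  by apply: ereal_inf_lbound; exists s.
apply: distribution_function_le_right => s' ss'.
have /ereal_inf_lt[_ [s1 [s10 fs1] <-]] : (rearrangement mu f x < s'%:E)%E.
  by apply: le_lt_trans rs _; rewrite lte_fin.
rewrite lte_fin => s1s'; apply: le_trans fs1.
by apply: le_distribution_function; exact: ltW.
Qed.

Lemma rearrangement_ge0 x : (0 <= rearrangement mu f x)%E.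
Proof. by apply: le_ereal_inf_tmp => _ [s [s0 _] <-]; rewrite lee_fin. Qed.

(** At 0 the rearrangement is infinite when [f] is essentially unbounded. At
[x > 0] some level set has measure less than [x], because these sets decrease to
the empty set. *)
Lemma rearrangement_fin_num x : 0 < x -> rearrangement mu f x \is a fin_num.
Proof.
move=> x0; rewrite ge0_fin_numE ?rearrangement_ge0//.
pose F (n : nat) := [set t | n%:R < `|f t|].
have FE : \bigcap_n F n = set0.
  apply/seteqP; split => // t /(_ (Num.truncn `|f t|).+1 I) /=.
  by apply/negP; rewrite -leNgt ltW// truncnS_gt.
have : mu (F n) @[n --> \oo] --> mu (\bigcap_n F n).
  apply: nonincreasing_cvg_mu.
  - by rewrite ltey_eq fin_num_measure//; exact: measurable_level.
  - by move=> n; exact: measurable_level.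
  - by rewrite FE.
  - move=> m n mn; apply/subsetPset => t /=; apply: le_lt_trans.
    by rewrite ler_nat.
rewrite FE measure0 => /fine_cvgP[_ /cvgrPdist_lt /(_ _ x0)] [n _ /(_ n (leqnn _))] /=.
rewrite sub0r normrN ger0_norm ?fine_ge0// => Fx.
apply: le_lt_trans (ltry n%:R); rewrite rearrangement_le//.
rewrite /distribution_function -/(F n) -[leLHS]fineK ?lee_fin ?ltW//.
by apply: fin_num_measure; exact: measurable_level.
Qed.

Local Notation D := (`]0, fine (mu [set: T])[%classic : set R).
Local Notation fstar := (fun x => fine (rearrangement mu f x)).

Lemma rearrangement_level s : 0 <= s ->
  D `&` [set x | s < fstar x] =
  `]0, fine (distribution_function mu f s)[%classic.
Proof.
move=> s0; have muT : mu [set: T] \is a fin_num by exact: fin_num_measure.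
have fin : distribution_function mu f s \is a fin_num.
  by apply: fin_num_measure; exact: measurable_level.
have fE x : 0 < x -> (s < fstar x) = (x < fine (distribution_function mu f s)).
  move=> x0; rewrite -lte_fin fineK ?rearrangement_fin_num//.
  by rewrite ltNge rearrangement_le// -ltNge -lte_fin fineK.
apply/seteqP; split => x /=; rewrite !in_itv/=.
  by move=> [/andP[x0 _]]; rewrite fE// x0.
move=> /andP[x0 xs]; rewrite fE// x0 xs; split => //=.
apply: (lt_le_trans xs); apply: fine_le => //.
by apply: le_measure; rewrite ?inE//; exact: measurable_level.
Qed.

Lemma measurable_rearrangement : measurable_fun D fstar.
Proof.
apply: (measurability (@RGenOInfty.G R)) => [|/= _ [_ [s ->] <-]].
  exact: RGenOInfty.measurableE.
have [s0|s0] := leP 0 s.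
  rewrite (_ : _ `&` _ = `]0, fine (distribution_function mu f s)[%classic)//.
  rewrite -rearrangement_level//; congr (_ `&` _).
  by apply/seteqP; split => t /=; rewrite in_itv/= andbT.
rewrite (_ : _ `&` _ = D)//; apply/seteqP; split => x //= [] // Dx.
by split => //=; rewrite in_itv/= andbT (lt_le_trans s0)// fine_ge0// rearrangement_ge0.
Qed.

(** Equimeasurability, restricted to nonnegative levels: the level set of the
rearrangement is an interval starting at 0 of length [mu (|f| > s)]. *)
Lemma lebesgue_measure_rearrangement s : 0 <= s ->
  lebesgue_measure (D `&` [set x | s < fstar x]) = distribution_function mu f s.
Proof.
move=> s0; rewrite rearrangement_level// lebesgue_measure_itv/= lte_fin.
have fin : distribution_function mu f s \is a fin_num.
  by apply: fin_num_measure; exact: measurable_level.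
case: ltP => [_|]; first by rewrite oppr0 addr0 fineK.
rewrite -lee_fin fineK// => fs; apply/eqP; rewrite eq_le fs andbT.
exact: measure_ge0.
Qed.

End rearrangement.

Section exponent_rearrangement.
Context (R : realType) (d : measure_display) (T : measurableType d).
Variables (mu : {finite_measure set T -> \bar R}) (p : exponent T R).

Lemma exponentially_integrable_rearrangement :
  (forall a : R, 1 < a ->
     (\int[lebesgue_measure]_(x in `]0%R, fine (mu [set: T])[)
        ((a `^ fine (rearrangement mu p x))%R)%:E < +oo)%E) <->
  exponentially_integrable mu p.
Proof.
have mp : measurable_fun [set: T] p := exponent_measurable p.
have p0 t : 0 < p t := exponent_gt0 p t.
have Dy : (lebesgue_measure (`]0%R, fine (mu [set: T])[%classic : set R) < +oo)%E.
  by rewrite lebesgue_measure_itv/=; case: ifP => // _; rewrite ltry.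
have tailsE : exponential_tails (@lebesgue_measure R)
    `]0%R, fine (mu [set: T])[%classic (fun x => fine (rearrangement mu p x)) <->
    exponential_tails mu [set: T] p.
  have E n : (@lebesgue_measure R) ((`]0%R, fine (mu [set: T])[%classic : set R) `&`
      [set x : R | n%:R < fine (rearrangement mu p x)]) =
      mu ([set: T] `&` [set t | n%:R < p t]).
    rewrite lebesgue_measure_rearrangement// setTI; congr (mu _).
    by apply/seteqP; split => t /=; rewrite gtr0_norm.
  split=> h a /h [C Ca]; exists C => n; apply: le_trans (Ca n).
    by rewrite le_eqVlt; apply/orP; left; apply/eqP; exact/esym/E.
  by rewrite le_eqVlt; apply/orP; left; apply/eqP; exact: E.
have JE : exponentially_integrable mu p <->
    forall a : R, 1 < a -> (\int[mu]_(t in [set: T]) ((a `^ p t)%R)%:E < +oo)%E.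
  split=> h a a1; have := h a a1; rewrite /modular /= gtr0_norm//; exact: lt_trans a1.
apply: (iff_trans _ (iff_trans tailsE _)); first last.
- apply: (iff_trans _ (iff_sym JE)); apply: iff_sym.
  apply: exponential_tailsP => //; first by rewrite ltey_eq fin_num_measure.
  by move=> t _; exact: ltW.
- apply: exponential_tailsP => //; first exact: measurable_rearrangement.
  by move=> x _; rewrite fine_ge0// rearrangement_ge0.
Qed.

End exponent_rearrangement.

(** * Subspaces of normed spaces and isomorphic restrictions *)

Section normed_subspaces.
Context (R : realType).
Implicit Types E F : normedModType R.

Lemma closure_normP E (V : set E) x :
  closure V x <-> forall e : R, 0 < e -> exists2 v, V v & `|x - v| < e.
Proof.
split=> [Vx e e0|Vx B /nbhs_ballP[e /= e0 xeB]].
  have [v [Vv]] := Vx _ (nbhsx_ballx x e e0).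
  by rewrite -ball_normE /= => xv; exists v.
have [v Vv xv] := Vx _ e0; exists v; split => //.
by apply: xeB; rewrite -ball_normE.
Qed.

Lemma is_subspace_closure E (V : set E) : is_subspace V -> is_subspace (closure V).
Proof.
move=> [V0 VD]; split; first exact: subset_closure.
move=> a x y /closure_normP Vx /closure_normP Vy; apply/closure_normP => e e0.
have a1 : 0 < `|a| + 1 by rewrite ltr_wpDl.
have [v Vv xv] := Vx (e / 2 / (`|a| + 1)) ltac:(by rewrite !divr_gt0).
have [w Vw yw] := Vy (e / 2) ltac:(by rewrite divr_gt0).
exists (a *: v + w); first exact: VD.
rewrite opprD addrACA -scalerBr (le_lt_trans (ler_normD _ _))//.
rewrite normrZ [e]splitr ltr_leD ?(ltW yw)//.
apply: (@le_lt_trans _ _ ((`|a| + 1) * `|x - v|)).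
  by rewrite ler_wpM2r// lerDl.
by rewrite -ltr_pdivlMl// mulrC.
Qed.

Lemma is_subspace_finite_sums E (e : nat -> E) :
  is_subspace [set x | exists (n : nat) (a : nat -> R), x = \sum_(k < n) a k *: e k].
Proof.
split; first by exists 0%N, (fun=> 0); rewrite big_ord0.
move=> c _ _ [m [a ->]] [n [b ->]].
(* Pads both combinations with zeros to a common length. *)
pose ext k (a : nat -> R) i := if (i < k)%N then a i else 0.
have extE k k' (a' : nat -> R) : (k <= k')%N ->
    \sum_(i < k) a' i *: e i = \sum_(i < k') ext k a' i *: e i.
  move=> kk'; rewrite (big_ord_widen k' (fun i => a' i *: e i))//.
  rewrite big_mkcond; apply: eq_bigr => i _; rewrite /ext.
  by case: ifP => // _; rewrite scale0r.
exists (maxn m n), (fun i => c * ext m a i + ext n b i).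
rewrite (extE m (maxn m n)) ?leq_maxl// (extE n (maxn m n)) ?leq_maxr//.
rewrite scaler_sumr -big_split /=; apply: eq_bigr => i _.
by rewrite scalerDl scalerA.
Qed.

Lemma is_subspace_closed_span E (e : nat -> E) : is_subspace (closed_span e).
Proof. exact/is_subspace_closure/is_subspace_finite_sums. Qed.

Lemma closed_span_mem E (e : nat -> E) n : closed_span e (e n).
Proof.
apply: subset_closure; exists n.+1, (fun k => (k == n)%:R).
rewrite big_ord_recr /= eqxx scale1r big1 ?add0r// => i _.
by rewrite ltn_eqF ?ltn_ord// scale0r.
Qed.

(** Continuity of the inverse at 0 keeps the inverse image of some ball inside
the unit ball of [V]; the estimate then extends to [V] by homogeneity. *)
Lemma iso_onto_image_bounded_below E F (f : {linear E -> F}) (V : set E) :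
  is_subspace V -> iso_onto_image f V ->
  exists2 C : R, 0 < C & forall x, V x -> `|x| <= C * `|f x|.
Proof.
move=> [V0 VD] [_ [g gK cg]].
have fV0 : (f @` V) 0 by exists 0 => //; rewrite linear0.
have g0 : g 0 = 0 by rewrite -(linear0 f) gK.
have : g @ within (f @` V) (nbhs (0 : F)) --> (0 : E).
  by rewrite -[X in _ --> X]g0; move/subspace_continuousP : cg; apply.
move=> /cvgrPdist_lt/(_ _ ltr01); rewrite near_withinE.
move=> /nbhs_ballP[e /= e0 eV].
exists (2 / e); first by rewrite divr_gt0.
move=> x Vx; have Z a y : V y -> V (a *: y).
  by move=> Vy; rewrite -[_ *: _]addr0; exact: VD.
have [fx0|fx0] := eqVneq (f x) 0.
  have -> : x = 0 by rewrite -(gK _ Vx) fx0.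
  by rewrite linear0 !normr0 mulr0.
have nfx0 : 0 < `|f x| by rewrite normr_gt0.
pose c := e / 2 / `|f x|; have c0 : 0 < c by rewrite !divr_gt0.
have := eV (f (c *: x)); rewrite -ball_normE /= sub0r normrN linearZ/= normrZ.
rewrite (gtr0_norm c0) /c divfK ?gt_eqF// -/c.
rewrite ltr_pdivrMr// ltr_pMr// ltr1n => /(_ isT).
rewrite -linearZ/= => /(_ (imageP _ (Z c _ Vx))).
rewrite gK; last exact: Z.
rewrite sub0r normrN normrZ (gtr0_norm c0) => cx.
have cV : c^-1 = 2 / e * `|f x| by rewrite /c; field; rewrite !gt_eqF.
by rewrite -cV -(ler_pM2l c0) mulfV ?gt_eqF// ltW.
Qed.

(** The inverse is Lipschitz on the image, with constant [C]. *)
Lemma bounded_below_iso_onto_image E F (f : {linear E -> F}) (V : set E) (C : R) :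
  continuous f -> is_subspace V -> (forall x, V x -> `|x| <= C * `|f x|) ->
  iso_onto_image f V.
Proof.
move=> cf [V0 VD] VC; split; first exact: continuous_subspaceT.
have VB x y : V x -> V y -> V (x - y).
  by move=> Vx Vy; rewrite addrC -scaleN1r; exact: VD.
have f_inj x y : V x -> V y -> f x = f y -> x = y.
  move=> Vx Vy fxy; apply/eqP; rewrite -subr_eq0 -normr_le0.
  by rewrite (le_trans (VC _ (VB _ _ Vx Vy)))// linearB/= fxy subrr normr0 mulr0.
pose g y := xget 0 [set x | V x /\ f x = y].
have gV y : (f @` V) y -> V (g y) /\ f (g y) = y.
  move=> [x Vx fx]; rewrite /g; case: xgetP => [z -> //|].
  by move=> /(_ x) /not_andP[].
have gK x : V x -> g (f x) = x.
  move=> Vx; have [Vg fg] := gV _ (imageP f Vx); exact: f_inj.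
exists g => //; apply/subspace_continuousP => _ [x Vx <-].
suff : g @ within (f @` V) (nbhs (f x)) --> x.
  by rewrite /from_subspace gK.
apply/cvgrPdist_lt => e e0; rewrite near_withinE.
apply/nbhs_ballP; exists (e / (`|C| + 1)) => /=; first by rewrite divr_gt0 ?ltr_wpDl.
move=> y; rewrite -ball_normE /= => xy Vy; have [Vg fg] := gV _ Vy.
rewrite (le_lt_trans (VC _ (VB _ _ Vx Vg)))// linearB/= fg.
apply: (@le_lt_trans _ _ ((`|C| + 1) * `|f x - y|)).
  by rewrite ler_wpM2r// (le_trans (ler_norm _))// lerDl.
by rewrite -ltr_pdivlMl ?ltr_wpDl// mulrC.
Qed.

End normed_subspaces.

(** * Classes of functions and the norm of the inclusion *)

Section function_lattice_classes.
Context (R : realType) (d : measure_display) (T : measurableType d).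
Variables (mu : {measure set T -> \bar R}) (X : function_lattice mu).
Implicit Types u v : fl_space X.

Definition fl_of (f : T -> R) (Xf : fl_mem X f) : fl_space X :=
  fl_class (FlFun (introT (fl_predP X f) Xf)).

Lemma fl_ofE f (Xf : fl_mem X f) : {ae mu, forall t, fl_of Xf t = f t}.
Proof. exact: fl_classK. Qed.

Lemma norm_fl_of f (Xf : fl_mem X f) : `|fl_of Xf| = fl_norm X f.
Proof. exact: fl_norm_class. Qed.

Lemma fl_reprP u : fl_mem X u.
Proof. exact: fl_funP. Qed.

Lemma measurable_fl_repr u : measurable_fun [set: T] u.
Proof. exact: fl_measurable (fl_reprP u). Qed.

Lemma fl_space_ext u v : {ae mu, forall t, u t = v t} -> u = v.
Proof. by move=> uv; rewrite -[u]fl_reprK -[v]fl_reprK; apply/eq_fl_class. Qed.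

Lemma fl_linE (a : R) u v : {ae mu, forall t, fl_repr (a *: u + v) t = a * u t + v t}.
Proof.
have : fl_class (a *: repr u + repr v) = a *: u + v.
  by rewrite linearP/= !fl_reprK.
by move=> <-; exact: fl_classK.
Qed.

Lemma fl_zeroE : {ae mu, forall t, fl_repr (0 : fl_space X) t = 0}.
Proof. exact: (fl_classK (0 : fl_fun X)). Qed.

Lemma fl_scaleE_ae (a : R) u : {ae mu, forall t, fl_repr (a *: u) t = a * u t}.
Proof.
have := fl_linE a u 0; rewrite addr0.
by apply: filterS2 fl_zeroE => t -> ->; rewrite addr0.
Qed.

Lemma fl_addE_ae u v : {ae mu, forall t, fl_repr (u + v) t = u t + v t}.
Proof.
by have := fl_linE 1 u v; rewrite scale1r; apply: filterS => t ->; rewrite mul1r.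
Qed.

Lemma fl_subE_ae u v : {ae mu, forall t, fl_repr (u - v) t = u t - v t}.
Proof.
have := fl_linE (-1) v u; rewrite scaleN1r addrC.
by apply: filterS => t ->; rewrite mulN1r addrC.
Qed.

Lemma fl_sumE_ae n (u : 'I_n -> fl_space X) :
  {ae mu, forall t, fl_repr (\sum_(i < n) u i) t = \sum_(i < n) u i t}.
Proof.
elim: n u => [|n IH] u.
  by rewrite big_ord0; apply: filterS fl_zeroE => t ->; rewrite big_ord0.
rewrite big_ord_recr /=.
apply: filterS2 (fl_addE_ae (\sum_(i < n) u (widen_ord (leqnSn n) i)) (u ord_max))
  (IH (fun i => u (widen_ord (leqnSn n) i))) => t -> ->.
by rewrite big_ord_recr.
Qed.

(** Classes add and scale only almost everywhere, so linearity of the integral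
does not apply directly to the representatives that [fl_repr] chooses. *)
Lemma Rintegral_fl_linear (D : set T) (w : T -> R) (c : R) u v :
  measurable D -> measurable_fun [set: T] w ->
  mu.-integrable D (EFin \o (fun t => u t * w t)) ->
  mu.-integrable D (EFin \o (fun t => v t * w t)) ->
  \int[mu]_(t in D) (fl_repr (c *: u + v) t * w t) =
  c * \int[mu]_(t in D) (u t * w t) + \int[mu]_(t in D) (v t * w t).
Proof.
move=> mD mw iu iv.
have icu : mu.-integrable D (EFin \o (fun t => c * (u t * w t))).
  exact: (integrableZl mD c iu).
rewrite -RintegralZl// -RintegralD//; congr fine.
apply: ae_eq_integral => //.
- apply/measurable_EFinP/measurable_funTS; apply: measurable_funM => //.
  exact: measurable_fl_repr.
- exact: (measurable_int mu (integrableD mD icu iv)).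
by apply: filterS (fl_linE c u v) => t -> _; rewrite mulrDl mulrA.
Qed.

End function_lattice_classes.

Section Linfty_classes.
Context (R : realType) (d : measure_display) (T : measurableType d).
Variable (mu : {measure set T -> \bar R}).

(** When the measure is null, every property holds almost everywhere and the
norm vanishes by convention, whence the case distinction. *)
Lemma Linfty_ae_le (u : fl_space (Linfty mu)) : {ae mu, forall t, `|u t| <= `|u|}.
Proof.
have [/eqP mu0|muN0] := boolP (mu setT == 0%E); first by exists [set: T]; split.
have y1 : (1 <= +oo :> \bar R)%E by exact: leey.
have fi := fl_reprP u.
have : ('N[mu]_+oo[EFin \o u] <= `|u|%:E)%E.
  by rewrite (finite_norm_fine (Lfun_Sub y1 fi)).
rewrite unlock lt0e muN0 measure_ge0/= => /ess_supP.
by apply: filterS => t; rewrite /= lee_fin.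
Qed.

Lemma Linfty_bounded (f : T -> R) (M : R) : measurable_fun [set: T] f -> 0 <= M ->
  {ae mu, forall t, `|f t| <= M} -> Linfty_mem mu f /\ Linfty_norm mu f <= M.
Proof.
move=> mf M0 fM.
have le : ('N[mu]_+oo[EFin \o f] <= M%:E)%E.
  rewrite unlock; case: ifPn => [_|_]; last by rewrite lee_fin.
  by apply/ess_supP; apply: filterS fM => t ft; rewrite /= lee_fin.
have flty : ('N[mu]_+oo[EFin \o f] < +oo)%E by rewrite (le_lt_trans le) ?ltry.
split; first by rewrite /Linfty_mem/= inE; apply/andP; split; rewrite inE.
by rewrite /Linfty_norm -lee_fin fineK// ge0_fin_numE// Lnorm_ge0.
Qed.

Lemma Linfty_norm_le (u : fl_space (Linfty mu)) (M : R) : 0 <= M ->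
  {ae mu, forall t, `|u t| <= M} -> `|u| <= M.
Proof. by move=> M0 uM; exact: (Linfty_bounded (measurable_fl_repr u) M0 uM).2. Qed.

End Linfty_classes.

Section inclusion_norm.
Context (R : realType) (d : measure_display) (T : measurableType d).
Variables (mu : {finite_measure set T -> \bar R}) (p : exponent T R).
Local Notation i := (Linfty_embedding mu p).
Local Notation Lp := (variable_Lebesgue mu p).

Lemma Linfty_embeddingE (u : fl_space (Linfty mu)) :
  {ae mu, forall t, fl_repr (i u) t = u t}.
Proof. exact: fl_inclE. Qed.

Lemma norm_Linfty_embedding (u : fl_space (Linfty mu)) :
  `|i u| = luxemburg_norm mu p u.
Proof. exact: fl_norm_class. Qed.

Lemma variable_Lebesgue_mem_bounded (f : T -> R) (M : R) :
  measurable_fun [set: T] f -> {ae mu, forall t, `|f t| <= M} ->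
  variable_Lebesgue_mem mu p f.
Proof.
move=> mf fM; apply: Linfty_sub_variable_Lebesgue.
apply: (@Linfty_bounded _ _ _ _ f `|M| mf _ _).1 => //.
by apply: filterS fM => t /le_trans; apply; exact: ler_norm.
Qed.

Lemma luxemburg_norm_bounded (f : T -> R) (M : R) :
  measurable_fun [set: T] f -> 0 <= M -> {ae mu, forall t, `|f t| <= M} ->
  luxemburg_norm mu p f <= M * luxemburg_norm mu p (cst 1).
Proof.
move=> mf M0 fM; have L1 : variable_Lebesgue_mem mu p (cst 1).
  apply: (variable_Lebesgue_mem_bounded (M := 1)) => //.
  by apply: nearW => t /=; rewrite normr1.
have := luxemburg_normZ M L1; rewrite (ger0_norm M0) => <-.
apply: (luxemburg_normS mf (variable_Lebesgue_memZ M L1)).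
apply: filterS fM => t /le_trans; apply.
by rewrite -[X in `|X|]/(M * 1) mulr1 ler_norm.
Qed.

Lemma norm_Linfty_embedding_le (u : fl_space (Linfty mu)) :
  `|i u| <= luxemburg_norm mu p (cst 1) * `|u|.
Proof.
rewrite norm_Linfty_embedding mulrC; apply: luxemburg_norm_bounded => //.
  exact: measurable_fl_repr.
exact: Linfty_ae_le.
Qed.

Lemma continuous_Linfty_embedding : continuous i.
Proof.
apply/bounded_linear_continuous/linear_boundedP.
near=> M => u; apply: (le_trans (norm_Linfty_embedding_le u)).
by rewrite ler_wpM2r.
Unshelve. all: by end_near. Qed.

Lemma Linfty_indic (E : set T) : measurable E -> Linfty_mem mu (\1_E).
Proof.
move=> mE; apply: (@Linfty_bounded _ _ _ _ _ 1 _ _ _).1 => //.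
by apply: nearW => t; rewrite indicE; case: (_ \in _); rewrite ?normr1 ?normr0.
Qed.

End inclusion_norm.

(** * Order continuity, L-weak and M-weak compactness *)

Section order_continuity.
Context (R : realType) (d : measure_display) (T : measurableType d).
Variables (mu : {finite_measure set T -> \bar R}) (p : exponent T R).
Local Notation i := (Linfty_embedding mu p).

Definition order_continuous_indicators :=
  forall E : nat -> set T, (forall n, measurable (E n)) ->
    {ae mu, forall t, (\1_(E n) t : R) @[n --> \oo] --> (0 : R)} ->
    luxemburg_norm mu p \1_(E n) @[n --> \oo] --> (0 : R).

Lemma norm_indic (E : set T) t : `|\1_E t : R| = \1_E t.
Proof. by rewrite ger0_norm. Qed.

Lemma norm_indic_le1 (E : set T) t : `|\1_E t : R| <= 1.
Proof. by rewrite norm_indic indicE; case: (_ \in _). Qed.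

Lemma small_norm_small_set : exponentially_integrable mu p ->
  forall r : R, 0 < r -> exists2 e : R, 0 < e &
    forall E, measurable E -> (mu E <= e%:E)%E -> luxemburg_norm mu p \1_E <= r.
Proof.
move=> J r r0; have [e e0 He] := small_integral_small_norm J r0.
exists e => // E mE muE; apply: He => //.
  by apply: nearW => t; exact: norm_indic_le1.
by under eq_integral do rewrite norm_indic; rewrite integral_indic// setIT.
Qed.

(** By dominated convergence the measures of the sets tend to 0. *)
Lemma exponentially_integrable_order_continuous :
  exponentially_integrable mu p -> order_continuous_indicators.
Proof.
move=> J E mE E0.
have muE : mu (E n) @[n --> \oo] --> 0%E.
  have mI n : measurable_fun [set: T] (EFin \o (\1_(E n) : T -> R)).
    by apply/measurable_EFinP.
  have [] := @dominated_convergence _ _ _ mu [set: T] measurableT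
    (fun n => EFin \o \1_(E n)) (cst 0%E) (cst 1%E) mI.
  - exact: measurable_cst.
  - by apply: filterS E0 => t Et _; apply: cvg_EFin => //; exact: nearW.
  - exact: (finite_measure_integrable_cst mu 1 measurableT).
  - by apply: nearW => t n _ /=; rewrite lee_fin norm_indic_le1.
  move=> _ _; rewrite integral0.
  by under eq_fun do rewrite integral_indic// setIT.
apply/cvgrPdist_le => r r0.
have [e e0 He] := small_norm_small_set J r0.
have /fine_cvgP[_ /cvgrPdist_le /(_ _ e0)] := muE.
apply: filterS => n; rewrite sub0r normrN ger0_norm ?fine_ge0// => En.
rewrite sub0r normrN ger0_norm ?luxemburg_norm_ge0//; apply: He => //.
by rewrite -[leLHS]fineK ?lee_fin// fin_num_measure.
Qed.

(** A function of the unit ball of L^oo is bounded by 1 almost everywhere, so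
its truncation to a set is dominated by the indicator of that set. *)
Lemma order_continuous_L_weakly_compact :
  order_continuous_indicators -> L_weakly_compact i.
Proof.
move=> oc A mA A0; have := oc A mA A0.
have le n : (ereal_sup [set (fl_norm (variable_Lebesgue mu p)
    (fun t => fl_repr (i u) t * \1_(A n) t))%:E | u in unit_ball (fl_space (Linfty mu))]
    <= (luxemburg_norm mu p \1_(A n))%:E)%E.
  apply: ge_ereal_sup => _ [u u1 <-]; rewrite lee_fin.
  apply: luxemburg_normS.
  - by apply: measurable_funM => //; exact: measurable_fl_repr.
  - apply: (@variable_Lebesgue_mem_bounded _ _ _ mu p _ 1) => //.
    by apply: nearW => t; exact: norm_indic_le1.
  - apply: filterS2 (Linfty_embeddingE p u) (Linfty_ae_le u).
    move=> t iu ut; rewrite normrM [X in X * _](_ : _ = `|fl_repr u t|); last first.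
      by congr (`|_|); exact: iu.
    by rewrite ler_piMl// (le_trans ut).
move=> nA; apply: (@squeeze_cvge _ _ _ _ (cst 0%E) _
  (fun n => (luxemburg_norm mu p \1_(A n))%:E)).
- apply: nearW => n; rewrite le andbT.
  apply: (@le_trans _ _ (fl_norm (variable_Lebesgue mu p)
    (fun t => fl_repr (i 0) t * \1_(A n) t))%:E).
    by rewrite lee_fin luxemburg_norm_ge0.
  by apply: ereal_sup_ubound; exists 0 => //; rewrite /unit_ball /= normr0.
- exact: cvg_cst.
- by apply: cvg_EFin => //; exact: nearW.
Qed.

(** The supports of disjoint functions have indicators that tend to 0: almost
every point lies in at most one of them. Truncating a function to its support
does not change it. *)
Lemma L_weakly_compact_M_weakly_compact : L_weakly_compact i -> M_weakly_compact i.
Proof.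
move=> Lwc u [M uM] du.
have M1 : 0 < `|M| + 1 by rewrite ltr_wpDl.
pose A n := [set t | fl_repr (u n) t != 0].
have mA n : measurable (A n).
  rewrite (_ : A n = [set: T] `&` fl_repr (u n) @^-1` [set~ 0]).
    by apply: measurable_fl_repr => //; exact: measurableC.
  by rewrite setTI; apply/seteqP; split => t /= /eqP.
have A0 : {ae mu, forall t, (\1_(A n) t : R) @[n --> \oo] --> (0 : R)}.
  have : {ae mu, forall t, forall m n, m != n -> Num.min `|u m t| `|u n t| = 0}.
    apply: ae_foralln => m; apply: ae_foralln => n.
    have [->|mn] := eqVneq m n; first by apply: nearW.
    by apply: filterS (du _ _ mn) => t ->.
  apply: filterS => t ut; apply/cvgrPdist_le => e e0.
  have [[m mA']|nA] := pselect (exists m, A m t); last first.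
    apply: nearW => n; rewrite sub0r normrN norm_indic indicE memNset ?ltW//.
    by move=> Ant; apply: nA; exists n.
  exists m.+1 => // n /= mn.
  rewrite sub0r normrN norm_indic indicE memNset ?ltW// => Ant.
  have := ut m n (negbT (ltn_eqF mn)).
  rewrite /Num.min; case: ifP => _ /normr0_eq0 h.
    by move: mA'; rewrite /A /= h eqxx.
  by move: Ant; rewrite /A /= h eqxx.
have /fine_cvgP[fin sup0] := Lwc A mA A0.
apply/cvgrPdist_le => e e0.
have eM : 0 < e / (`|M| + 1) by rewrite divr_gt0.
move/cvgrPdist_le : sup0 => /(_ _ eM); apply: filterS2 fin => n finn.
rewrite sub0r normrN => supe; rewrite sub0r normrN normr_id.
have un1 : `|(`|M| + 1)^-1 *: u n| <= 1.
  rewrite normrZ normfV (gtr0_norm M1) ler_pdivrMl// mulr1 (le_trans (uM n))//.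
  by rewrite (le_trans (ler_norm _))// lerDl.
have iE : `|i ((`|M| + 1)^-1 *: u n)| = (`|M| + 1)^-1 * `|i (u n)|.
  by rewrite linearZ/= normrZ normfV (gtr0_norm M1).
set w := (`|M| + 1)^-1 *: u n in un1 iE.
suff : `|i w| <= e / (`|M| + 1).
  by rewrite iE mulrC ler_pM2r ?invr_gt0.
apply: le_trans supe; rewrite ger0_norm; last first.
  apply: fine_ge0; apply: (@le_trans _ _ (fl_norm (variable_Lebesgue mu p)
    (fun t => fl_repr (i w) t * \1_(A n) t))%:E).
    by rewrite lee_fin luxemburg_norm_ge0.
  by apply: ereal_sup_ubound; exists w.
rewrite -lee_fin fineK//; apply: (@le_trans _ _ (fl_norm (variable_Lebesgue mu p)
    (fun t => fl_repr (i w) t * \1_(A n) t))%:E); last first.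
  by apply: ereal_sup_ubound; exists w.
rewrite lee_fin; apply: luxemburg_normS; first exact: measurable_fl_repr.
  have miw := measurable_fl_repr (i w).
  apply: (@variable_Lebesgue_memS _ _ _ mu p _ (fl_repr (i w))).
  - exact: measurable_funM.
  - exact: (fl_reprP (i w)).
  - by apply: nearW => t; rewrite normrM ler_piMr// norm_indic_le1.
apply: filterS2 (Linfty_embeddingE p w)
  (fl_scaleE_ae (`|M| + 1)^-1 (u n)) => t iw wu.
rewrite indicE; case: (boolP (t \in A n)) => [_|tA]; first by rewrite mulr1.
rewrite mulr0 normr0 normr_le0; apply/eqP.
rewrite [LHS](iw : _ = fl_repr w t) wu.
by move: tA; rewrite notin_setE /A /= => /negP; rewrite negbK => /eqP ->; rewrite mulr0.
Qed.

End order_continuity.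

(** * Functionals and weak topologies *)

Section weak_topology.
Context (R : realType).
Implicit Types E : normedModType R.

Lemma exists_dual E (phi : E -> R) (C : R) :
  (forall a u v, phi (a *: u + v) = a * phi u + phi v) ->
  (forall u, `|phi u| <= C * `|u|) ->
  exists f : dual E, forall u, sval f u = phi u.
Proof.
move=> lphi phiC.
have lin : linear (phi : E -> R^o) by move=> a u v; exact: lphi.
pose L : {linear E -> R^o} :=
  HB.pack (phi : E -> R^o) (GRing.isLinear.Build _ _ _ _ (phi : E -> R^o) lin).
have cL : continuous L.
  apply/bounded_linear_continuous/linear_boundedP.
  near=> M => u; apply: (le_trans (phiC u)).
  by rewrite ler_wpM2r.
by exists (exist _ L cL).
Unshelve. all: by end_near. Qed.

Lemma dual_linear E (f : dual E) a u v :
  sval f (a *: u + v) = a * sval f u + sval f v.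
Proof. by rewrite linearP. Qed.

Lemma dual_bounded E (f : dual E) : exists C : R, forall u, `|sval f u| <= C * `|u|.
Proof.
have /linear_boundedP bf := (linear_bounded_continuous (sval f)).2 (svalP f).
by have [C fC] := filter_ex bf; exists C.
Qed.

Lemma fmap_ultrafilter I J (U : set_system I) (f : I -> J) :
  UltraFilter U -> UltraFilter (f @ U).
Proof.
move=> UU; split; first exact: fmap_proper_filter.
move=> G PG fUG; apply/seteqP; split => [B GB|B]; last exact: fUG.
have [//|UB] := in_ultra_setVsetC (f @^-1` B) UU.
have GB' : G (~` B) by apply: fUG.
by have [z [Bz /(_ Bz)]] := filter_ex (filterI GB GB').
Qed.

(** Compactness of a segment; this plays the part of a generalized limit. *)
Lemma ultrafilter_bounded_cvg I (U : set_system I) (x : I -> R) (M : R) :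
  UltraFilter U -> (forall j, `|x j| <= M) -> exists l : R,
    x j @[j --> U] --> l /\ `|l| <= M.
Proof.
move=> UU xM; have := @segment_compact R (- M) M.
rewrite compact_ultra => /(_ _ (fmap_ultrafilter x UU))[].
- apply: (@filterE _ U) => j /=; rewrite in_itv/= -ler_norml; exact: xM.
- by move=> l [/=]; rewrite in_itv/= -ler_norml => lM xl; exists l.
Qed.

(** One half of Grothendieck's double limit criterion, for the triangular matrix
of values. Let [x] be a weak cluster point of [s] along a nonprincipal
ultrafilter, and let [psi] be the limit of the [phi j] along it, a continuous
functional since the [phi j] are uniformly bounded. Each [phi j] is eventually
1 along [s], so [phi j x = 1] and [psi x = 1]; but [psi] vanishes at every
[s n], so [psi x = 0]. *)
Lemma weakly_precompact_double_limit E (A : set E) (s : nat -> E)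
    (phi : nat -> dual E) (C : R) :
  precompact (A : set (weak E)) -> (forall n, A (s n)) ->
  (forall j u, `|sval (phi j) u| <= C * `|u|) ->
  ~ (forall j n, sval (phi j) (s n) = (j < n)%N%:R).
Proof.
move=> Ac As phiC phis.
have [U [UU oU]] := ultraFilterLemma (@eventually_filter).
have PU : ProperFilter U by exact: ultra_proper.
have lim u : exists l : R,
    (sval (phi j) u : R) @[j --> U] --> l /\ `|l| <= C * `|u|.
  by apply: ultrafilter_bounded_cvg => j; exact: phiC.
(* A Banach limit of the [phi j]. *)
have [psi psi_spec] := choice lim.
have psiE u : (sval (phi j) u : R) @[j --> U] --> psi u := (psi_spec u).1.
have psi_lin a u v : psi (a *: u + v) = a * psi u + psi v.
  have h : (sval (phi j) (a *: u + v) : R) @[j --> U] --> a * psi u + psi v.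
    rewrite (_ : (fun j => _) = (fun j => a * sval (phi j) u + sval (phi j) v)).
      by apply: (@cvgD R R); [apply: (@cvgM R); [exact: cvg_cst|exact: psiE]|exact: psiE].
    by apply/funext => j; exact: dual_linear.
  exact: (@cvg_unique _ (@Rhausdorff R) _ _ _ _ (psiE _) h).
have psiC u : `|psi u| <= C * `|u| := (psi_spec u).2.
have [f fE] := exists_dual psi_lin psiC.
move: Ac; rewrite precompactE compact_ultra.
move=> /(_ _ (fmap_ultrafilter (s : nat -> weak E) UU))[].
  by apply: (@filterE _ U) => n; exact: (@subset_closure (weak E) A _ (As n)).
move=> x [_ /cvg_weak sx].
have phix j : sval (phi j) x = 1.
  have h : sval (phi j) (s n) @[n --> U] --> (sval (phi j) x : R) by exact: sx.
  apply: (@cvg_unique _ (@Rhausdorff R) _ _ _ _ h).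
  apply: cvg_near_cst; apply: oU; exists j.+1 => // n /= jn.
  by rewrite phis jn.
have psix : psi x = 1.
  apply: (@cvg_unique _ (@Rhausdorff R) _ _ _ _ (psiE x)).
  by apply: cvg_near_cst; apply: nearW => j; rewrite phix.
have psis n : psi (s n) = 0.
  apply: (@cvg_unique _ (@Rhausdorff R) _ _ _ _ (psiE (s n))).
  apply: cvg_near_cst; apply: oU; exists n => // j /= nj.
  by rewrite phis ltnNge nj.
have fx : sval f (s n) @[n --> U] --> (sval f x : R) by exact: sx.
have : (0 : R) = 1.
  rewrite -psix -fE; apply: (@cvg_unique _ (@Rhausdorff R) _ _ _ _ _ fx).
  by apply: cvg_near_cst; apply: nearW => n; rewrite fE psis.
by move/eqP; rewrite eq_sym oner_eq0.
Qed.

End weak_topology.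

(** * Disjoint bumps when a power of the exponent is not integrable *)

Section weighted_integrals.
Context (R : realType) (d : measure_display) (T : measurableType d).
Variables (mu : {finite_measure set T -> \bar R}) (p : exponent T R).
Variables (a : R) (A : set T).
Hypotheses (a0 : 0 < a) (mA : measurable A).
Local Notation IA := (\int[mu]_(t in A) ((a `^ p t)%R)%:E)%E.
Hypothesis IAy : (IA < +oo)%E.

Let mexp : measurable_fun [set: T] (fun t => a `^ p t).
Proof. exact: (measurableT_comp (measurable_powRr a) (exponent_measurable p)). Qed.

Let IA_ge0 : (0 <= IA)%E.
Proof. by apply: integral_ge0 => t _; rewrite lee_fin powR_ge0. Qed.

Let IA_fin : IA \is a fin_num. Proof. by rewrite ge0_fin_numE. Qed.

(** The pairing of [x] with [a ^ q] is controlled by the two modulars: compare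
[x] with [a] and replace the smaller one by the larger one in the product
[x * a ^ (q - 1)]. *)
Lemma mul_powR_le (x q : R) : 0 <= x -> 1 <= q ->
  x * a `^ q <= a * (x `^ q + a `^ q).
Proof.
move=> x0 q1; have q0 : 0 < q by exact: lt_le_trans q1.
have [xa|ax] := leP x a.
  apply: (@le_trans _ _ (a * a `^ q)); first by rewrite ler_wpM2r// powR_ge0.
  by rewrite ler_wpM2l ?(ltW a0)// lerDr powR_ge0.
rewrite -(mulr_powRB1 (ltW a0) q0) mulrCA ler_wpM2l ?(ltW a0)//.
apply: (@le_trans _ _ (x `^ q)); last by rewrite lerDl mulr_ge0 ?powR_ge0// ltW.
rewrite -(mulr_powRB1 x0 q0) ler_wpM2l//.
by rewrite ge0_ler_powR ?nnegrE ?subr_ge0// ltW.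
Qed.

Lemma weighted_integral_le (v : fl_space (variable_Lebesgue mu p)) (r : R) : `|v| < r ->
  (\int[mu]_(t in A) `|(v t * a `^ p t)%:E| <= (r * a * (1 + fine IA))%:E)%E.
Proof.
move=> vr; have r0 : 0 < r by exact: le_lt_trans vr.
have mv := measurable_fl_repr v.
have vr1 := modular_le1 (fl_reprP v) vr.
have mvr : measurable_fun [set: T] (fun t => v t / r) by exact: measurable_funM.
have mmod := measurable_modular p mvr.
apply: (@le_trans _ _ (\int[mu]_(t in A)
    ((r * a)%:E * ((`|v t / r| `^ p t)%:E + (a `^ p t)%:E)))%E).
  apply: ge0_le_integral => //.
  - apply: measurableT_comp => //; apply/measurable_EFinP/measurable_funTS.
    exact: measurable_funM.
  - apply: measurable_funTS; apply: measurable_funeM.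
    by apply: emeasurable_funD; [exact: mmod|exact/measurable_EFinP].
  - move=> t _; rewrite -EFinD -EFinM lee_fin normrM (ger0_norm (powR_ge0 _ _)).
    have h := mul_powR_le (normr_ge0 (v t / r)) (exponent_ge1 p t).
    rewrite -(ler_pM2l r0) !mulrA in h; apply: le_trans h.
    by rewrite normrM normfV (gtr0_norm r0) [r * _]mulrC divfK ?gt_eqF.
rewrite ge0_integralZl_EFin//; last 3 first.
- by move=> t _; rewrite adde_ge0// lee_fin powR_ge0.
- by apply: measurable_funTS; apply: emeasurable_funD;
    [exact: mmod|exact/measurable_EFinP].
- by rewrite mulr_ge0// ltW.
rewrite ge0_integralD//; last 3 first.
- exact: measurable_funTS.
- by move=> t _; rewrite lee_fin powR_ge0.
- by apply: measurable_funTS; exact/measurable_EFinP.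
rewrite [leRHS]EFinM; apply: lee_wpmul2l; first by rewrite lee_fin mulr_ge0// ltW.
rewrite EFinD fineK// leeD2r//; apply: le_trans vr1.
by apply: ge0_subset_integral => // t _; rewrite lee_fin powR_ge0.
Qed.

Lemma weighted_integrable (v : fl_space (variable_Lebesgue mu p)) :
  mu.-integrable A (EFin \o (fun t => v t * a `^ p t)).
Proof.
apply/integrableP; split.
  apply/measurable_EFinP/measurable_funTS; apply: measurable_funM => //.
  exact: measurable_fl_repr.
have v1 : `|v| < `|v| + 1 by rewrite ltrDl.
by apply: le_lt_trans (weighted_integral_le v1) _; rewrite ltry.
Qed.

Definition weighted_integral (v : fl_space (variable_Lebesgue mu p)) : R :=
  \int[mu]_(t in A) (v t * a `^ p t).

Lemma weighted_integral_linear c u v :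
  weighted_integral (c *: u + v) = c * weighted_integral u + weighted_integral v.
Proof.
by rewrite /weighted_integral Rintegral_fl_linear//; exact: weighted_integrable.
Qed.

(** The integral of [|v| a ^ p] is at most [r a (1 + IA)] for every
[r > |v|], because the modular of [v / r] is then at most 1. *)
Lemma weighted_integral_bounded v :
  `|weighted_integral v| <= a * (1 + fine IA) * `|v|.
Proof.
have c0 : 0 < a * (1 + fine IA) by rewrite mulr_gt0// ltr_wpDr// fine_ge0.
apply/ler_addgt0Pr => e e0.
have vr : `|v| < `|v| + e / (a * (1 + fine IA)) by rewrite ltrDl divr_gt0.
apply: (@le_trans _ _ (\int[mu]_(t in A) `|v t * a `^ p t|)).
  by apply: le_normr_Rintegral => //; exact: weighted_integrable.
have := weighted_integral_le vr; set r := _ + _ => h.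
have -> : a * (1 + fine IA) * `|v| + e = r * a * (1 + fine IA).
  by rewrite -[RHS]mulrA /r mulrDl divfK ?gt_eqF// [in LHS]mulrC.
rewrite -lee_fin; apply: le_trans h; rewrite /Rintegral fineK//.
by have := integrable_abse (weighted_integrable v); move/integrable_fin_num; apply.
Qed.

End weighted_integrals.

Section disjoint_bumps.
Context (R : realType) (d : measure_display) (T : measurableType d).
Variables (mu : {finite_measure set T -> \bar R}) (p : exponent T R).

(** Disjoint sets on which the exponential of base [a] has a finite integral
greater than 1; their indicators span a copy of c_0. *)
Record bumps (a : R) (E : nat -> set T) : Prop := Bumps {
  bumps_base : 1 < a;
  bumps_measurable : forall j, measurable (E j);
  bumps_disjoint : trivIset setT E;
  bumps_gt1 : forall j, (1 < \int[mu]_(t in E j) ((a `^ p t)%R)%:E)%E;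
  bumps_lty : forall j, (\int[mu]_(t in E j) ((a `^ p t)%R)%:E < +oo)%E }.

(** If [a ^ p] is not integrable, its integrals over the sets [F n] where
[p <= n] are finite and tend to infinity. So any [N] is followed by some [M]
such that the integral over [F M] exceeds that over [F N] by more than 1. *)
Lemma not_exponentially_integrable_bumps :
  ~ exponentially_integrable mu p -> exists a E, bumps a E.
Proof.
move=> /existsNP[a /not_implyP[a1 Ny]].
have a0 : 0 < a by lra.
have IT : (\int[mu]_t ((a `^ p t)%R)%:E = +oo)%E.
  apply/eqP; rewrite -leye_eq leNgt; apply/negP => h; apply: Ny.
  by rewrite /modular /= gtr0_norm.
have mp : measurable_fun [set: T] p := exponent_measurable p.
have mexp : measurable_fun [set: T] (fun t => ((a `^ p t)%R)%:E).
  by apply/measurable_EFinP; exact: (measurableT_comp (measurable_powRr a)).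
have exp0 t : (0 <= ((a `^ p t)%R)%:E)%E by rewrite lee_fin powR_ge0.
pose F n := [set t | p t <= n%:R].
have mF n : measurable (F n).
  rewrite (_ : F n = [set: T] `&` p @^-1` `]-oo, n%:R]); first exact: mp.
  by rewrite setTI; apply/seteqP; split => t /=; rewrite in_itv.
have FS m n : (m <= n)%N -> F m `<=` F n.
  by move=> mn t /= /le_trans; apply; rewrite ler_nat.
pose I A := (\int[mu]_(t in A) ((a `^ p t)%R)%:E)%E.
have IF n : (I (F n) < +oo)%E.
  apply: (@le_lt_trans _ _ ((a ^+ n)%:E * mu (F n))%E); last first.
    by rewrite lte_mul_pinfty// ?lee_fin ?exprn_ge0 ?(ltW a0)// ltey_eq fin_num_measure.
  rewrite -integral_cst//; apply: ge0_le_integral => //.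
  - exact: measurable_funTS.
  - by move=> t Ft; rewrite lee_fin -powR_mulrn ?(ltW a0)// ler_powR// ltW.
have Icvg : I (F n) @[n --> \oo] --> +oo%E.
  have FT : \bigcup_n F n = [set: T].
    apply/seteqP; split => // t _; exists (Num.truncn (p t)).+1 => //.
    by rewrite /F /= ltW// truncnS_gt.
  rewrite -IT -FT; apply: ge0_nondecreasing_set_cvg_integral => //.
  - by move=> m n mn; apply/subsetPset/FS.
  - by move=> n; exact: measurable_funTS.
have step N : exists M, (N < M)%N /\ (1 < I (F M `\` F N))%E.
  move/cvgeyPge : Icvg => /(_ (fine (I (F N)) + 2)) [M0 _ H].
  pose M := maxn M0 N.+1; exists M; split; first exact: leq_maxr.
  have := H M (leq_maxl _ _).
  have FNM : F N `<=` F M by apply: FS; rewrite ltnW// leq_maxr.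
  have -> : I (F M) = (I (F N) + I (F M `\` F N))%E.
    rewrite -{1}(setDUK FNM) /I ge0_integral_setU//.
    - exact: measurableD.
    - exact: measurable_funTS.
    - by apply/disj_setPS => t [? []].
  move=> h; rewrite ltNge; apply/negP => le1; move: h; apply/negP; rewrite -ltNge.
  have fI : I (F N) \is a fin_num.
    by rewrite ge0_fin_numE ?IF// integral_ge0.
  apply: (@le_lt_trans _ _ (I (F N) + 1)%E); first exact: leeD2l.
  by rewrite -[I _]fineK// -EFinD lte_fin; lra.
have [nxt nxtP] := choice step.
pose N := fix N j := if j is j.+1 then nxt (N j) else 0%N.
have NS j : (N j < N j.+1)%N by exact: (nxtP (N j)).1.
have Nmono i j : (i <= j)%N -> (N i <= N j)%N.
  move=> ij; rewrite -(subnKC ij); elim: (j - i)%N => [|k IH]; first by rewrite addn0.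
  by rewrite addnS (leq_trans IH)// ltnW.
pose E j := F (N j.+1) `\` F (N j).
have mE j : measurable (E j) by exact: measurableD.
exists a, E; split=> //.
- apply: ltn_trivIset => i j ij; apply/seteqP; split => // t [[Ft _] [_ nF]].
  by apply: nF; apply: FS Ft; exact: Nmono.
- by move=> j; exact: (nxtP (N j)).2.
- move=> j; apply: le_lt_trans (IF (N j.+1)); apply: ge0_subset_integral => //.
  + exact: measurable_funTS.
  + exact: subDsetl.
Qed.

Variables (a : R) (E : nat -> set T).
Hypothesis B : bumps a E.
Let mE := bumps_measurable B.
Let a1 := bumps_base B.
Let a0 : 0 < a. Proof. exact: lt_trans a1. Qed.
Local Notation i := (Linfty_embedding mu p).
Local Notation I j := (\int[mu]_(t in E j) ((a `^ p t)%R)%:E)%E.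

(** The modular of [a] times the indicator of [E j] is the integral of [a ^ p]
over [E j], which is greater than 1. *)
Lemma bump_norm j : a^-1 <= luxemburg_norm mu p \1_(E j).
Proof.
apply: luxemburg_norm_ge; first by rewrite invr_gt0.
  by apply: Linfty_sub_variable_Lebesgue; exact: Linfty_indic.
apply: (lt_le_trans (bumps_gt1 B j)).
rewrite integral_mkcond /modular le_eqVlt; apply/orP; left; apply/eqP.
apply: eq_integral => t _; rewrite invrK patchE indicE.
have pt : p t != 0 by rewrite gt_eqF// exponent_gt0.
by case: (t \in E j); rewrite ?mul1r ?(gtr0_norm a0)// mul0r normr0 powR0.
Qed.

Definition bump j : fl_space (Linfty mu) :=
  @fl_of _ _ _ mu (Linfty mu) _ (Linfty_indic mu (mE j)).

Lemma bumpE : {ae mu, forall t, forall j, bump j t = \1_(E j) t}.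
Proof. by apply: ae_foralln => j; exact: fl_ofE. Qed.

(** The norm is at most 1. If it were less, the indicator would vanish almost
everywhere, contrary to the lower bound on its Luxemburg norm. *)
Lemma norm_bump j : `|bump j| = 1.
Proof.
apply/eqP; rewrite eq_le; apply/andP; split.
  apply: Linfty_norm_le => //; apply: filterS (bumpE) => t ->.
  exact: norm_indic_le1.
rewrite leNgt; apply/negP => u1.
have : luxemburg_norm mu p \1_(E j) <= 0 * luxemburg_norm mu p (cst 1).
  apply: luxemburg_norm_bounded => //; apply: filterS2 bumpE (Linfty_ae_le (bump j)).
  move=> t ->; rewrite norm_indic indicE; case: (_ \in _) => //= u1'.
  by have := le_lt_trans u1' u1; rewrite ltxx.
rewrite mul0r => /(le_trans (bump_norm j)).
by rewrite leNgt invr_gt0 a0.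
Qed.

Lemma bump_pairwise_disjoint : pairwise_disjoint bump.
Proof.
move=> m n mn; apply: filterS bumpE => t ut; rewrite !ut !norm_indic !indicE.
have /trivIsetP/(_ m n Logic.I Logic.I mn) Emn := bumps_disjoint B.
case: (boolP (t \in E m)) => [|_]; case: (boolP (t \in E n)) => [|_];
  rewrite /= ?minxx ?(min_l ler01) ?(min_r ler01)// !inE => tn tm.
by have : set0 t by rewrite -Emn.
Qed.

(** Used for the single bumps and for the coefficients of their combinations. *)
Lemma bump_lower_bound j (v : fl_space (variable_Lebesgue mu p)) (c : R) :
  {ae mu, forall t, t \in E j -> `|c| <= `|v t|} -> `|c| <= a * `|v|.
Proof.
move=> cv; have L : variable_Lebesgue_mem mu p \1_(E j).
  by apply: Linfty_sub_variable_Lebesgue; exact: Linfty_indic.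
have : luxemburg_norm mu p (c *: \1_(E j)) <= `|v|.
  apply: luxemburg_normS (fl_reprP v) _.
    exact: (variable_Lebesgue_memZ c L).1.
  apply: filterS cv => t h; rewrite -[(c *: _) t]/(c * \1_(E j) t) indicE.
  case: (boolP (t \in E j)) => tE; first by rewrite mulr1 h.
  by rewrite mulr0 normr0.
rewrite luxemburg_normZ// => h; rewrite -ler_pdivrMl// mulrC.
by apply: le_trans h; rewrite ler_wpM2l// bump_norm.
Qed.

Lemma norm_embedding_bump j : a^-1 <= `|i (bump j)|.
Proof.
have := @bump_lower_bound j (i (bump j)) 1; rewrite normr1 => h.
rewrite -[a^-1]mulr1 ler_pdivrMl//; apply: h.
apply: filterS2 (Linfty_embeddingE p (bump j)) bumpE.
move=> t iu ut tE; rewrite [X in `|X|](_ : _ = bump j t); last exact: iu.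
by rewrite ut indicE tE normr1.
Qed.

Lemma M_weakly_compact_no_bumps : ~ M_weakly_compact i.
Proof.
move=> Mwc; have : `|i (bump n)| @[n --> \oo] --> (0 : R).
  apply: Mwc; last exact: bump_pairwise_disjoint.
  by exists 1 => n; rewrite norm_bump.
have a20 : 0 < a^-1 / 2 by rewrite divr_gt0// invr_gt0.
move/cvgrPdist_le => /(_ _ a20) [n _ /(_ n (leqnn _))] /=.
rewrite sub0r normrN normr_id => h; have := le_trans (norm_embedding_bump n) h.
have : 0 < a^-1 by rewrite invr_gt0.
lra.
Qed.

Lemma bump_sumE n (c : nat -> R) : {ae mu, forall t,
  fl_repr (\sum_(k < n) c k *: bump k) t = \sum_(k < n) c k * \1_(E k) t}.
Proof.
have sE : {ae mu, forall t, forall k, fl_repr (c k *: bump k) t = c k * \1_(E k) t}.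
  apply: ae_foralln => k; apply: filterS2 (fl_scaleE_ae (c k) (bump k)) bumpE.
  by move=> t -> ->.
apply: filterS2 (fl_sumE_ae (fun k : 'I_n => c k *: bump k)) sE => t -> h.
by apply: eq_bigr => k _.
Qed.

Lemma bump_sum_on n (c : nat -> R) t k : t \in E k ->
  \sum_(l < n) c l * \1_(E l) t = if (k < n)%N then c k else 0.
Proof.
move=> tk; have tl l : l != k -> \1_(E l) t = 0 :> R.
  move=> lk; rewrite indicE memNset// => tl.
  have /trivIsetP/(_ l k Logic.I Logic.I lk) Elk := bumps_disjoint B.
  by have : set0 t by rewrite -Elk; split=> //; exact: set_mem.
case: ltnP => kn.
  rewrite (bigD1 (Ordinal kn))//= indicE tk mulr1 big1 ?addr0// => l lk.
  by rewrite tl ?mulr0//; apply: contraNneq lk => lk; exact/eqP/val_inj.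
by rewrite big1// => l _; rewrite tl ?mulr0// ltn_eqF// (leq_trans _ kn).
Qed.

(** For a finite combination, [bump_lower_bound] bounds each coefficient, and the
supremum norm is the largest of these. The estimate passes to the closure since
both sides are continuous. *)
Lemma bump_span_bounded_below (x : fl_space (Linfty mu)) :
  closed_span bump x -> `|x| <= a * `|i x|.
Proof.
suff span y : (exists (n : nat) (c : nat -> R), y = \sum_(k < n) c k *: bump k) ->
    `|y| <= a * `|i y|.
  move=> /closure_normP cx; apply/ler_addgt0Pr => e e0.
  set K := luxemburg_norm mu p (cst 1).
  have K0 : 0 <= K by exact: luxemburg_norm_ge0.
  have aK : 0 < a * K + 1 by rewrite ltr_wpDl// mulr_ge0// ltW.
  have [v /span vle xv] := cx _ (divr_gt0 e0 aK).
  have iv : `|i v| <= `|i x| + K * `|x - v|.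
    rewrite -[v in `|i v|](subKr x) linearB/= (le_trans (ler_normB _ _))// lerD2l.
    exact: norm_Linfty_embedding_le.
  have xvE : `|x| <= `|v| + `|x - v| by rewrite -{1}[x](subrK v) addrC ler_normD.
  have xve : (a * K + 1) * `|x - v| <= e by rewrite -ler_pdivlMl// mulrC ltW.
  have aux (rx rv s t r : R) : rx <= rv + s -> rv <= a * t -> t <= r + K * s ->
      (a * K + 1) * s <= e -> rx <= a * r + e.
    move=> h1 h2 h3 h4; have := ler_wpM2l (ltW a0) h3.
    by clear -h1 h2 h4; lra.
  exact: aux xvE vle iv xve.
move=> [n [c ->]] /=; clear x y; set x := \sum_(k < n) _.
have xE := bump_sumE n c; rewrite -/x in xE.
have xEk : {ae mu, forall t, forall k, t \in E k ->
    fl_repr x t = if (k < n)%N then c k else 0}.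
  by apply: filterS xE => t -> k tk; exact: bump_sum_on.
have ix := fl_inclE (@Linfty_sub_variable_Lebesgue _ _ _ mu p) x.
have ck k : (k < n)%N -> `|c k| <= a * `|i x|.
  move=> kn; apply: (@bump_lower_bound k).
  apply: filterS2 ix xEk => t ixt xt tk.
  rewrite [X in _ <= `|X|](_ : _ = fl_repr x t); last exact: ixt.
  by rewrite (xt k tk) kn.
apply: Linfty_norm_le; first by rewrite mulr_ge0// ltW.
apply: filterS2 xE xEk => t xt xtk.
have [[k tk]|nE] := pselect (exists k, t \in E k).
  rewrite (xtk k tk); case: ifPn => [/ck//|_].
  by rewrite normr0 mulr_ge0// ltW.
rewrite xt big1 ?normr0 ?mulr_ge0 ?(ltW a0)// => k _; rewrite indicE.
by case: (boolP (_ \in _)) => [tk|_]; [exfalso; apply: nE; exists k|rewrite mulr0].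
Qed.

Lemma disjointly_strictly_singular_no_bumps : ~ disjointly_strictly_singular i.
Proof.
apply; exists bump; split.
- exact: norm_bump.
- exact: bump_pairwise_disjoint.
- apply: (bounded_below_iso_onto_image (@continuous_Linfty_embedding _ _ _ mu p)).
    exact: is_subspace_closed_span.
  exact: bump_span_bounded_below.
Qed.

Let I_fin j : I j \is a fin_num.
Proof.
rewrite ge0_fin_numE ?(bumps_lty B)//.
by apply: integral_ge0 => t _; rewrite lee_fin powR_ge0.
Qed.

Let I_gt1 j : 1 < fine (I j).
Proof. by rewrite -lte_fin fineK// (bumps_gt1 B). Qed.

Let mexp : measurable_fun [set: T] (fun t => a `^ p t).
Proof. exact: (measurableT_comp (measurable_powRr a) (exponent_measurable p)). Qed.

(** The average over [E j] for the weight [a ^ p]; these functionals are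
biorthogonal to the bumps. *)
Definition bump_pairing j (v : fl_space (variable_Lebesgue mu p)) : R :=
  (fine (I j))^-1 * weighted_integral a (E j) v.

(** The bound does not depend on [j] because the integrals over [E j] are at
least 1. *)
Lemma bump_pairing_bounded j v : `|bump_pairing j v| <= 2 * a * `|v|.
Proof.
have I0 : 0 < fine (I j) by exact: lt_trans (I_gt1 j).
rewrite /bump_pairing normrM normfV (gtr0_norm I0) ler_pdivrMl//.
apply: (le_trans (weighted_integral_bounded a0 (mE j) (bumps_lty B j) v)).
rewrite mulrA ler_wpM2r//; have := I_gt1 j; move: (fine (I j)) => s s1.
have -> : s * (2 * a) = a * (s + s) by ring.
by rewrite ler_wpM2l ?(ltW a0)// lerD2r ltW.
Qed.

Lemma bump_pairing_linear j c u v :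
  bump_pairing j (c *: u + v) = c * bump_pairing j u + bump_pairing j v.
Proof.
rewrite /bump_pairing (weighted_integral_linear a0 (mE j) (bumps_lty B j)).
by rewrite mulrDr mulrCA.
Qed.

Lemma bump_pairing_partial_sum j n :
  bump_pairing j (i (\sum_(k < n) 1 *: bump k)) = (j < n)%N%:R.
Proof.
set x := \sum_(k < n) _; rewrite /bump_pairing /weighted_integral.
have -> : \int[mu]_(t in E j) (fl_repr (i x) t * a `^ p t) =
    \int[mu]_(t in E j) ((j < n)%N%:R * a `^ p t).
  congr fine; apply: ae_eq_integral => //.
  - exact: measurable_int (weighted_integrable a0 (mE j) (bumps_lty B j) (i x)).
  - apply/measurable_EFinP/measurable_funTS; exact: measurable_funM.
  apply: filterS2 (Linfty_embeddingE p x)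
    (bump_sumE n (fun=> 1)) => t ix xt Et; congr (_%:E).
  rewrite [X in X * _ = _](_ : _ = fl_repr x t); last exact: ix.
  by rewrite xt (bump_sum_on n (fun=> 1) (mem_set Et)); case: ltnP.
rewrite RintegralZl//.
  rewrite mulrCA [X in _ * (_ * X)](_ : _ = fine (I j))//.
  by rewrite mulVf ?mulr1// gt_eqF// (lt_trans _ (I_gt1 j)).
apply/integrableP; split; first exact/measurable_EFinP/measurable_funTS.
under eq_integral do rewrite /= ger0_norm ?powR_ge0//.
exact: (bumps_lty B).
Qed.

Lemma weakly_compact_no_bumps : ~ weakly_compact i.
Proof.
move=> wc.
have [phi phiE] := choice (fun j =>
  exists_dual (bump_pairing_linear j) (bump_pairing_bounded j)).
apply: (@weakly_precompact_double_limit _ _ _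
  (fun n => i (\sum_(k < n) 1 *: bump k)) phi (2 * a) wc).
- move=> n; exists (\sum_(k < n) 1 *: bump k) => //.
  apply: Linfty_norm_le => //; apply: filterS (bump_sumE n (fun=> 1)) => t ->.
  have [[k tk]|nE] := pselect (exists k, t \in E k).
    by rewrite (bump_sum_on n (fun=> 1) tk); case: ifP; rewrite ?normr1 ?normr0.
  rewrite big1 ?normr0// => k _; rewrite indicE.
  by case: (boolP (_ \in _)) => [tk|_]; [exfalso; apply: nE; exists k|rewrite mulr0].
- by move=> j u; rewrite phiE; exact: bump_pairing_bounded.
- by move=> j n; rewrite phiE; exact: bump_pairing_partial_sum.
Qed.

End disjoint_bumps.

Section necessity.
Context (R : realType) (d : measure_display) (T : measurableType d).
Variables (mu : {finite_measure set T -> \bar R}) (p : exponent T R).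
Local Notation i := (Linfty_embedding mu p).

Lemma exponentially_integrable_by_bumps (P : Prop) :
  (forall a E, bumps mu p a E -> ~ P) -> P -> exponentially_integrable mu p.
Proof.
move=> noP HP; apply: contrapT => /not_exponentially_integrable_bumps[a [E aE]].
exact: (noP a E aE).
Qed.

Lemma M_weakly_compact_exponentially_integrable :
  M_weakly_compact i -> exponentially_integrable mu p.
Proof.
apply: exponentially_integrable_by_bumps => a E.
exact: M_weakly_compact_no_bumps.
Qed.

Lemma weakly_compact_exponentially_integrable :
  weakly_compact i -> exponentially_integrable mu p.
Proof.
apply: exponentially_integrable_by_bumps => a E.
exact: weakly_compact_no_bumps.
Qed.

Lemma disjointly_strictly_singular_exponentially_integrable :
  disjointly_strictly_singular i -> exponentially_integrable mu p.
Proof.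
apply: exponentially_integrable_by_bumps => a E.
exact: disjointly_strictly_singular_no_bumps.
Qed.

End necessity.

(** * Orthonormal families and rational vectors *)

Section dimension.
Context (R : realType).

(** The matrix of coefficients has more rows than columns, so some nonzero row
vector annihilates it. *)
Lemma linear_dependence (E : lmodType R) m (e : 'I_m -> E) (u : nat -> E) :
  (forall k, exists a : 'I_m -> R, u k = \sum_(i < m) a i *: e i) ->
  exists c : 'I_m.+1 -> R, (exists k, c k != 0) /\ \sum_(k < m.+1) c k *: u k = 0.
Proof.
move=> /choice[a uE]; pose A := \matrix_(k < m.+1, i < m) a k i.
have kerA : kermx A != 0.
  by rewrite kermx_eq0 /row_free neq_ltn ltnS rank_leq_col.
have /rowV0Pn[c /sub_kermxP cA c0] := kerA.
exists (c 0); split.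
  apply/existsP; rewrite -negb_forall; apply: contra c0 => /forallP c0.
  by apply/eqP/rowP => k; rewrite mxE; apply/eqP.
under eq_bigr do rewrite uE scaler_sumr.
rewrite exchange_big /= big1// => i _.
under eq_bigr do rewrite scalerA.
rewrite -scaler_suml; have /rowP/(_ i) := cA; rewrite !mxE.
by under eq_bigr do rewrite mxE; move=> ->; rewrite scale0r.
Qed.

Variables (E : lmodType R) (ip : E -> E -> R) (V : set E).
Hypothesis ip_linear : forall (a : R) (x y z : E),
  ip (a *: x + y) z = a * ip x z + ip y z.
Hypothesis ip_sym : forall x y, ip x y = ip y x.
Hypothesis V0 : V 0.
Hypothesis V_linear : forall (a : R) (x y : E), V x -> V y -> V (a *: x + y).
Hypothesis ip_gt0 : forall x, V x -> x != 0 -> 0 < ip x x.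

Let ip0 z : ip 0 z = 0.
Proof.
have := ip_linear 1 0 0 z; rewrite scale1r addr0 mul1r => /eqP.
by rewrite -subr_eq subrr eq_sym => /eqP.
Qed.

Lemma ip_suml n (a : nat -> R) (x : nat -> E) z :
  ip (\sum_(i < n) a i *: x i) z = \sum_(i < n) a i * ip (x i) z.
Proof.
elim: n => [|n IH]; first by rewrite !big_ord0 ip0.
by rewrite !big_ord_recr /= addrC ip_linear IH addrC.
Qed.

Lemma subspace_sum n (a : nat -> R) (x : nat -> E) :
  (forall i, (i < n)%N -> V (x i)) -> V (\sum_(i < n) a i *: x i).
Proof.
elim: n => [|n IH] Vx; first by rewrite big_ord0.
rewrite big_ord_recr /= addrC; apply: V_linear; first exact: Vx.
by apply: IH => k kn; apply: Vx; rewrite ltnS ltnW.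
Qed.

Definition orthonormal_family n (e : nat -> E) :=
  (forall k, (k < n)%N -> V (e k)) /\
  (forall k l, (k < n)%N -> (l < n)%N -> ip (e k) (e l) = (k == l)%:R).

Lemma ip_orthonormal_sum n (e : nat -> E) (a : nat -> R) : orthonormal_family n e ->
  ip (\sum_(i < n) a i *: e i) (\sum_(i < n) a i *: e i) = \sum_(i < n) a i ^+ 2.
Proof.
move=> [_ eo]; rewrite ip_suml; apply: eq_bigr => k _.
rewrite ip_sym ip_suml (bigD1 k)//= eo// eqxx mulr1 big1 ?addr0// => l lk.
by rewrite eo// (_ : (l == k :> nat) = false) ?mulr0//; exact: negbTE.
Qed.

(** Gram-Schmidt: a vector of [V] outside the span of the family built so far
has a nonzero component orthogonal to it. *)
Lemma orthonormal_exists :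
  (forall n (e : nat -> E), (forall k, (k < n)%N -> V (e k)) ->
     exists2 x, V x & forall a : nat -> R, x <> \sum_(k < n) a k *: e k) ->
  forall n, exists e, orthonormal_family n e.
Proof.
move=> big; elim=> [|n [e [Ve eo]]]; first by exists (fun=> 0).
have [x Vx xe] := big n e Ve.
pose y := - (1 : R) *: (\sum_(k < n) ip x (e k) *: e k) + x.
have Vy : V y by apply: V_linear => //; exact: (subspace_sum (fun k => ip x (e k)) Ve).
have y0 : y != 0.
  apply/eqP => y0; apply: (xe (fun k => ip x (e k))); apply/eqP.
  by rewrite -subr_eq0 addrC -scaleN1r -/y y0.
have ye l : (l < n)%N -> ip y (e l) = 0.
  move=> ln; rewrite ip_linear (ip_suml _ (fun k => ip x (e k))) (bigD1 (Ordinal ln))//=.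
  rewrite eo// eqxx mulr1 big1 ?addr0 ?mulN1r ?addNr// => k kl.
  by rewrite eo// (_ : (k == l :> nat) = false) ?mulr0//; exact: negbTE.
have yy := ip_gt0 Vy y0; pose s := (Num.sqrt (ip y y))^-1.
have s0 : 0 < s by rewrite invr_gt0 sqrtr_gt0.
have Z a u z : ip (a *: u) z = a * ip u z.
  by rewrite -[a *: u]addr0 ip_linear ip0 addr0.
exists (fun k => if (k < n)%N then e k else s *: y); split=> [k _|k l kn ln].
  by case: ifP => [/Ve//|_]; rewrite -[_ *: _]addr0; exact: V_linear.
move: kn; rewrite ltnS leq_eqVlt => /predU1P[->|kn];
  move: ln; rewrite ltnS leq_eqVlt => /predU1P[->|ln];
  rewrite ?ltnn ?kn ?ln ?eqxx.
- rewrite Z ip_sym Z mulrA -expr2 exprVn sqr_sqrtr ?(ltW yy)//.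
  by rewrite mulVf// gt_eqF.
- by rewrite Z ye// mulr0 gtn_eqF.
- by rewrite ip_sym Z ye// mulr0 ltn_eqF.
- exact: eo.
Qed.

End dimension.

Section rational_vectors.
Context (R : realType).

Lemma cvg_sum_ord n (f : nat -> 'I_n -> R) (l : 'I_n -> R) :
  (forall i, f k i @[k --> \oo] --> l i) ->
  (\sum_(i < n) f k i) @[k --> \oo] --> \sum_(i < n) l i.
Proof.
move=> fl.
apply: (@cvg_big R 'I_n _ 0 xpredT _ nat \oo (index_enum 'I_n) (fun i k => f k i) l).
- exact: add_continuous.
- by move=> i _; exact: fl.
Qed.

(** The Cauchy-Schwarz inequality in reverse: taking [q = x] would give
[(sum x_i^2)^2 <= K sum x_i^2]. Rational vectors suffice by density, and there
are countably many of them, which matters when the hypothesis holds only almost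
everywhere for each [q]. *)
Lemma le_sum_squares_rational n (x : 'I_n -> R) (K : R) : 0 <= K ->
  (forall q : 'I_n -> rat, (\sum_(i < n) ratr (q i) * x i) ^+ 2 <=
     K * \sum_(i < n) (ratr (q i) : R) ^+ 2) ->
  \sum_(i < n) x i ^+ 2 <= K.
Proof.
move=> K0 qK.
have approx (ki : nat * 'I_n) : exists q : rat, `|x ki.2 - ratr q| < ki.1.+1%:R^-1 :> R.
  have [q] := @rat_in_itvoo R (x ki.2 - ki.1.+1%:R^-1) (x ki.2 + ki.1.+1%:R^-1)
    ltac:(by rewrite ltrD2l gtrN// invr_gt0).
  by rewrite in_itv/= => q1; exists q; rewrite ltr_distlC.
have [q qE] := choice approx.
have qx i : (ratr (q (k, i)) : R) @[k --> \oo] --> x i.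
  apply/cvgrPdist_lt => e e0; have := near_infty_natSinv_lt (PosNum e0).
  by apply: filterS => k /= ke; exact: lt_trans (qE (k, i)) ke.
set S := \sum_(i < n) _.
have S2 : S ^+ 2 <= K * S.
  apply: (@ler_cvg_to nat \oo _ R
    (fun k => (\sum_(i < n) ratr (q (k, i)) * x i) ^+ 2)
    (fun k => K * \sum_(i < n) (ratr (q (k, i)) : R) ^+ 2)).
  - have sqx : \sum_(i < n) ratr (q (k, i)) * x i @[k --> \oo] --> S.
      by apply: cvg_sum_ord => i; rewrite expr2; apply: cvgM => //; exact: cvg_cst.
    by rewrite expr2; apply: cvgM.
  - apply: cvgM; first exact: cvg_cst.
    by apply: cvg_sum_ord => i; rewrite expr2; apply: cvgM.
  - by apply: nearW => k; exact: qK.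
have S0 : 0 <= S by apply: sumr_ge0 => i _; exact: sqr_ge0.
move: S0; rewrite le_eqVlt => /predU1P[<-//|S0].
by move: S2; rewrite expr2 ler_pM2r.
Qed.

End rational_vectors.

(** * Strict singularity *)

Section strict_singularity.
Context (R : realType) (d : measure_display) (T : measurableType d).

(** If the span had dimension [m], then [m + 1] of the vectors would be linearly
dependent; but disjointness makes the absolute value of a combination equal to
that of a single term at almost every point. *)
Lemma disjoint_span_infinite_dimensional (mu : {measure set T -> \bar R})
    (X : function_lattice mu) (u : nat -> fl_space X) :
  (forall n, `|u n| = 1) -> pairwise_disjoint u ->
  ~ finite_dimensional (closed_span u).
Proof.
move=> u1 du [m [e [_ eu]]].
have [c [[k ck] cu0]] := linear_dependence (fun k => eu _ (@closed_span_mem _ _ u k)).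
have ut0 : {ae mu, forall t, \sum_(l < m.+1) fl_repr (c l *: u l) t = 0}.
  have := fl_sumE_ae (fun l : 'I_m.+1 => c l *: u l); rewrite cu0.
  by apply: filterS2 (fl_zeroE X) => t -> <-.
have cuE : {ae mu, forall t, forall l : 'I_m.+1, fl_repr (c l *: u l) t = c l * u l t}.
  have : {ae mu, forall t, forall l : nat,
      fl_repr (c (inord l) *: u l) t = c (inord l) * u l t}.
    by apply: ae_foralln => l; exact: fl_scaleE_ae.
  by apply: filterS => t h l; have := h l; rewrite inord_val.
have dk : {ae mu, forall t, forall l : nat, l != k -> Num.min `|u k t| `|u l t| = 0}.
  apply: ae_foralln => l; have [->|lk] := eqVneq l (k : nat); first exact: nearW.
  rewrite eq_sym in lk; by apply: filterS (du _ _ lk) => t ->.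
have : u k = 0.
  apply: fl_space_ext; apply: filterS3 ut0 cuE (filterI dk (fl_zeroE X)).
  move=> t ut cut [dt ->]; apply/eqP/negPn/negP => ukt.
  have ul l : (l != k :> nat) -> u l t = 0.
    move=> lk; have := dt l lk; rewrite /Num.min; case: ifP => _ /normr0_eq0 //.
    by move/eqP; rewrite (negbTE ukt).
  move: ut; rewrite (bigD1 k)//= cut big1 ?addr0; last first.
    by move=> l lk; rewrite cut ul ?mulr0.
  by move/eqP; rewrite mulf_eq0 (negbTE ck) (negbTE ukt).
by move=> uk0; have := u1 k; rewrite uk0 normr0 => /eqP; rewrite eq_sym oner_eq0.
Qed.

Lemma strictly_singular_disjointly (mu : {measure set T -> \bar R})
    (X : function_lattice mu) (F : normedModType R) (f : {linear fl_space X -> F}) :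
  strictly_singular f -> disjointly_strictly_singular f.
Proof.
move=> ss [u [u1 du iso]]; apply: ss; exists (closed_span u); split => //.
- exact: is_subspace_closed_span.
- exact: closed_closure.
- exact: disjoint_span_infinite_dimensional.
Qed.

Variable mu : {finite_measure set T -> \bar R}.
Local Notation Loo := (fl_space (Linfty mu)).

Lemma Linfty_integrable (u : Loo) (w : T -> R) : mu.-integrable [set: T] (EFin \o w) ->
  mu.-integrable [set: T] (EFin \o (fun t => u t * w t)).
Proof.
move=> iw; have mw : measurable_fun [set: T] w.
  by apply/measurable_EFinP; exact: measurable_int iw.
have mu_ := measurable_fl_repr u.
apply/integrableP; split; first by apply/measurable_EFinP; exact: measurable_funM.
have := integrableZl measurableT `|u| (integrable_abse iw) => /integrableP[mabs].
apply: le_lt_trans; apply: ae_ge0_le_integral => //.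
- by apply: measurableT_comp => //; apply/measurable_EFinP; exact: measurable_funM.
- exact: measurableT_comp.
- apply: filterS (Linfty_ae_le u) => t ut _ /=.
  by rewrite normrM lee_fin normrM !normr_id ler_wpM2r.
Qed.

Lemma Linfty_integrable1 (u : Loo) : mu.-integrable [set: T] (EFin \o u).
Proof.
have := @Linfty_integrable u (cst 1) (finite_measure_integrable_cst mu 1 measurableT).
by apply: eq_integrable => // t _ /=; rewrite mulr1.
Qed.

Definition L2_product (u v : Loo) : R := \int[mu]_(t in [set: T]) (u t * v t).

Lemma L2_product_linear a u v w :
  L2_product (a *: u + v) w = a * L2_product u w + L2_product v w.
Proof.
rewrite /L2_product Rintegral_fl_linear//.
- exact: measurable_fl_repr.
- exact/Linfty_integrable/Linfty_integrable1.
- exact/Linfty_integrable/Linfty_integrable1.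
Qed.

Lemma L2_product_sym u v : L2_product u v = L2_product v u.
Proof. by apply: eq_Rintegral => t _; rewrite mulrC. Qed.

(** A theorem of Grothendieck. If [e] is an orthonormal family of [N] elements of
[V], then [(sum_k q_k e_k(t))^2 <= K sum_k q_k^2] for almost every [t], for each
rational [q], hence for all of them simultaneously. So
[sum_k e_k(t)^2 <= K], and integrating gives [N <= K mu(T)]. *)
Lemma finite_dimensional_L2_dominated (V : set Loo) (K : R) : is_subspace V ->
  0 <= K -> (forall u, V u -> `|u| ^+ 2 <= K * L2_product u u) ->
  finite_dimensional V.
Proof.
move=> [V0 VD] K0 VK; apply: contrapT => nfd.
have ip_gt0 u : V u -> u != 0 -> 0 < L2_product u u.
  move=> Vu u0; have := VK u Vu; rewrite ltNge; apply: contraPN => le0.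
  apply/negP; rewrite -ltNge; apply: (@le_lt_trans _ _ 0).
    by rewrite mulr_ge0_le0.
  by rewrite exprn_gt0// normr_gt0.
have big n (e : nat -> Loo) : (forall k, (k < n)%N -> V (e k)) ->
    exists2 x, V x & forall a : nat -> R, x <> \sum_(k < n) a k *: e k.
  move=> Ve; apply: contrapT => h; apply: nfd.
  exists n, (fun k => e k); split => [k|x Vx].
    exact: Ve.
  apply: contrapT => nx; apply: h; exists x => // a xa; apply: nx.
  by exists (fun k => a k).
pose N := (Num.truncn (K * fine (mu [set: T]))).+1.
have [e eo] := orthonormal_exists L2_product_linear L2_product_sym V0 VD ip_gt0 big N.
have pointwise (q : {ffun 'I_N -> rat}) : {ae mu, forall t,
    (\sum_(k < N) ratr (q k) * fl_repr (e k) t) ^+ 2 <=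
    K * \sum_(k < N) (ratr (q k) : R) ^+ 2}.
  (* Extends the coefficients to all natural numbers; only those below [N] count. *)
  pose a (k : nat) : R := ratr (q (inord k)).
  have aE (k : 'I_N) : a k = ratr (q k) by rewrite /a inord_val.
  pose x := \sum_(k < N) a k *: e k.
  have Vx : V x by apply: (subspace_sum V0 VD) => k kN; exact: eo.1.
  have xK := VK x Vx.
  rewrite (ip_orthonormal_sum L2_product_linear L2_product_sym a eo) in xK.
  have cE : {ae mu, forall t, forall k : nat,
      fl_repr (a k *: e k) t = a k * fl_repr (e k) t}.
    by apply: ae_foralln => k; exact: fl_scaleE_ae.
  apply: filterS3 (Linfty_ae_le x) (fl_sumE_ae (fun k : 'I_N => a k *: e k)) cE.
  move=> t xt xs ct; under [X in K * X]eq_bigr do rewrite -aE.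
  apply: le_trans xK; rewrite -[leLHS]real_normK ?num_real//.
  rewrite ler_sqr ?nnegrE//; apply: le_trans xt; rewrite xs.
  by under [X in _ <= `|X|]eq_bigr do rewrite ct aE.
have all : {ae mu, forall t, \sum_(k < N) (fl_repr (e k) t) ^+ 2 <= K}.
  have : {ae mu, forall t, forall n : nat,
      if unpickle n is Some q then
        (\sum_(k < N) ratr ((q : {ffun 'I_N -> rat}) k) * fl_repr (e k) t) ^+ 2 <=
        K * \sum_(k < N) (ratr (q k) : R) ^+ 2 else true}.
    by apply: ae_foralln => n; case: unpickle => [q|]; [exact: pointwise|exact: nearW].
  apply: filterS => t h; apply: le_sum_squares_rational => // q.
  have := h (pickle (finfun q)); rewrite pickleK.
  under eq_bigr do rewrite ffunE. under [X in K * X]eq_bigr do rewrite ffunE.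
  exact.
have : N%:R <= K * fine (mu [set: T]).
  have ii (k : nat) : mu.-integrable [set: T]
      (EFin \o (fun t => fl_repr (e k) t * fl_repr (e k) t)).
    exact/Linfty_integrable/Linfty_integrable1.
  rewrite -lee_fin EFinM fineK ?fin_num_measure// -integral_cst//.
  apply: (@le_trans _ _ (\int[mu]_t
      (\sum_(k < N) (fl_repr (e k) t * fl_repr (e k) t)%:E))%E); last first.
    apply: ae_ge0_le_integral => //.
    - by move=> t _; apply: sume_ge0 => k _; rewrite lee_fin -expr2 sqr_ge0.
    - by apply: emeasurable_sum => k; exact: measurable_int (ii k).
    - apply: filterS all => t h _; rewrite sumEFin lee_fin.
      by under eq_bigr do rewrite -expr2.
  rewrite ge0_integral_sum//; last 2 first.
  - by move=> k; exact: measurable_int (ii k).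
  - by move=> k t _; rewrite lee_fin -expr2 sqr_ge0.
  have ek (k : 'I_N) : (\int[mu]_t (fl_repr (e k) t * fl_repr (e k) t)%:E = 1%:E)%E.
    have := eo.2 k k (ltn_ord k) (ltn_ord k); rewrite eqxx /L2_product /Rintegral.
    move=> h; apply: etrans (congr1 EFin h); rewrite fineK//.
    exact: integrable_fin_num (ii k).
  under eq_bigr do rewrite ek.
  by rewrite sumEFin lee_fin sumr_const card_ord.
by rewrite leNgt truncnS_gt.
Qed.

Variable p : exponent T R.
Local Notation i := (Linfty_embedding mu p).

(** If [y] in [V] has supremum norm 1, then its Luxemburg norm is bounded below,
and therefore so is the integral of [|y|]. Since [|y| <= h + y^2 / h], choosing
[h] small bounds the integral of [y^2] below as well, so that the supremum norm
is dominated by the L^2 norm on [V]. *)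
Lemma exponentially_integrable_strictly_singular :
  exponentially_integrable mu p -> strictly_singular i.
Proof.
move=> J [V [sV _ nfd iso]]; apply: nfd.
have [C C0 VC] := iso_onto_image_bounded_below sV iso.
have r0 : 0 < (2 * C)^-1 by rewrite invr_gt0 mulr_gt0.
have [e e0 He] := small_integral_small_norm J r0.
set m := fine (mu [set: T]); have m0 : 0 <= m by exact: fine_ge0.
pose h := e / (2 * (m + 1)); have h0 : 0 < h.
  by rewrite divr_gt0// mulr_gt0// ltr_wpDl.
pose K := 2 / (h * e); have K0 : 0 < K by rewrite divr_gt0// mulr_gt0.
apply: (finite_dimensional_L2_dominated sV (ltW K0)) => u Vu.
have [->|u0] := eqVneq u 0.
  rewrite normr0 expr0n mulr_ge0 ?(ltW K0)//.
  by apply: Rintegral_ge0 => t _; rewrite -expr2 sqr_ge0.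
set s := `|u|; have s0 : 0 < s by rewrite normr_gt0.
pose y : Loo := s^-1 *: u + 0.
have Vy : V y by apply: sV.2 => //; exact: sV.1.
have y1 : `|y| = 1 by rewrite /y addr0 normrZ normfV (gtr0_norm s0) mulVf// gt_eqF.
have yy : L2_product y y = s^-1 ^+ 2 * L2_product u u.
  have Z a w z : L2_product (a *: w) z = a * L2_product w z.
    rewrite -[a *: w]addr0 L2_product_linear.
    suff -> : L2_product 0 z = 0 by rewrite addr0.
    have := L2_product_linear 1 0 0 z; rewrite scale1r addr0 mul1r => /eqP.
    by rewrite -subr_eq subrr eq_sym => /eqP.
  by rewrite /y addr0 Z L2_product_sym Z mulrA expr2.
suff yK : 1 <= K * L2_product y y.
  move: yK; rewrite yy mulrCA -ler_pdivrMl ?exprn_gt0 ?invr_gt0// mulr1.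
  by rewrite exprVn invrK.
rewrite leNgt; apply/negP => yK.
have : luxemburg_norm mu p y <= (2 * C)^-1.
  apply: He; first exact: measurable_fl_repr.
    by rewrite -y1; exact: Linfty_ae_le.
  have my := measurable_fl_repr y.
  apply: (@le_trans _ _ (\int[mu]_t (h%:E + (h^-1)%:E * (y t * y t)%:E))%E).
    apply: ge0_le_integral => //.
    - by apply/measurable_EFinP; exact: measurableT_comp.
    - apply: emeasurable_funD => //; apply: measurable_funeM.
      by apply/measurable_EFinP; exact: measurable_funM.
    - move=> t _; rewrite -EFinM -EFinD lee_fin.
      have -> : y t * y t = `|y t| ^+ 2 by rewrite real_normK ?num_real// expr2.
      rewrite -(ler_pM2l h0) mulrDr mulrA mulfV ?gt_eqF// mul1r.
      have := sqr_ge0 (`|y t| - h); have := normr_ge0 (y t); move: `|y t| => z.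
      by clear -h0 => z0; nra.
  rewrite ge0_integralD//; last 3 first.
  - by move=> t _; rewrite lee_fin ltW.
  - by move=> t _; rewrite -EFinM lee_fin mulr_ge0 ?invr_ge0 ?(ltW h0)// -expr2 sqr_ge0.
  - by apply: measurable_funeM; apply/measurable_EFinP; exact: measurable_funM.
  rewrite integral_cst// ge0_integralZl_EFin//; last 3 first.
  - by move=> t _; rewrite lee_fin -expr2 sqr_ge0.
  - by apply/measurable_EFinP; exact: measurable_funM.
  - by rewrite invr_ge0 ltW.
  have iyy : mu.-integrable [set: T] (EFin \o (fun t => y t * y t)).
    exact/Linfty_integrable/Linfty_integrable1.
  have -> : (\int[mu]_t (y t * y t)%:E = (L2_product y y)%:E)%E.
    by rewrite /L2_product /Rintegral fineK//; exact: integrable_fin_num iyy.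
  rewrite [X in (_ * X + _)%E](_ : _ = m%:E); last first.
    by rewrite fineK// fin_num_measure.
  rewrite -!EFinM -EFinD lee_fin.
  have hm : h * m <= e / 2.
    have -> : e / 2 = h * (m + 1) by rewrite /h; field; rewrite gt_eqF ?ltr_wpDl.
    by rewrite ler_pM2l// lerDl.
  have yh : h^-1 * L2_product y y <= e / 2.
    rewrite ler_pdivrMl// -(ler_pM2l K0) (le_trans (ltW yK))//.
    suff -> : K * (h * (e / 2)) = 1 by [].
    by rewrite /K; field; rewrite !gt_eqF.
  by rewrite [e]splitr lerD.
rewrite -norm_Linfty_embedding => iy.
have := VC y Vy; rewrite y1 => /le_trans/(_ (ler_wpM2l (ltW C0) iy)).
by rewrite invfM mulrCA mulfV ?gt_eqF// mulr1; lra.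
Qed.

End strict_singularity.

(** * Integral representation of functionals *)

Section densities.
Context (R : realType) (d : measure_display) (T : measurableType d).
Variable mu : {finite_measure set T -> \bar R}.

Section charge_of_additive.
Variable lam : set T -> R.
Hypothesis lam_add : forall A B, measurable A -> measurable B -> A `&` B = set0 ->
  lam (A `|` B) = lam A + lam B.
Hypothesis lam_ac : forall r : R, 0 < r -> exists2 e : R, 0 < e &
  forall A, measurable A -> (mu A <= e%:E)%E -> `|lam A| <= r.

Let nu (A : set T) : \bar R := (lam A)%:E.

Let lam0 : lam set0 = 0.
Proof.
have := lam_add measurable0 measurable0 (setI0 _); rewrite setU0 => /eqP.
by rewrite -subr_eq subrr eq_sym => /eqP.
Qed.

Let nu0 : nu set0 = 0%E. Proof. by rewrite /nu lam0. Qed.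

Let nu_fin A : measurable A -> nu A \is a fin_num. Proof. by []. Qed.

Let nu_sigma_additive : semi_sigma_additive nu.
Proof.
move=> F mF tF mUF.
have sumE n : (\sum_(0 <= k < n) nu (F k) = (lam (\big[setU/set0]_(k < n) F k))%:E)%E.
  elim: n => [|n IH]; first by rewrite big_geq// big_ord0 lam0.
  rewrite big_nat_recr//= IH big_ord_recr /= -EFinD lam_add//.
    by apply: bigsetU_measurable => k _.
  rewrite big_distrl big1//= => k _.
  by move/trivIsetP : tF => /(_ k n Logic.I Logic.I); apply; rewrite ltn_eqF.
pose G n := \bigcup_k F k `\` \big[setU/set0]_(k < n) F k.
have mS n : measurable (\big[setU/set0]_(k < n) F k) by apply: bigsetU_measurable => k _.
have mG n : measurable (G n) by apply: measurableD.
have lamG n : lam (\bigcup_k F k) = lam (\big[setU/set0]_(k < n) F k) + lam (G n).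
  rewrite -lam_add//; last by rewrite /G setDE setICA setICr setI0.
  by congr lam; rewrite setDUK//; exact: bigsetU_bigcup.
have muG : mu (G n) @[n --> \oo] --> 0%E.
  rewrite -(measure0 mu); have -> : set0 = \bigcap_n G n.
    apply/esym/seteqP; split => // t Gt; have [[k _ Fk] _] := Gt 0%N Logic.I.
    have [_] := Gt k.+1 Logic.I; apply.
    by rewrite big_ord_recr /=; right.
  apply: nonincreasing_cvg_mu => //.
  - by rewrite ltey_eq fin_num_measure.
  - exact: bigcap_measurable.
  - move=> m n mn; apply/subsetPset; apply: setDS.
    exact: subset_bigsetU.
under eq_fun do rewrite sumE.
apply: cvg_EFin; first exact: nearW.
apply/cvgrPdist_le => r r0; have [e e0 He] := lam_ac r0.
have /fine_cvgP[_ /cvgrPdist_le /(_ _ e0)] := muG.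
apply: filterS => n; rewrite sub0r normrN ger0_norm ?fine_ge0// => Gn.
rewrite /= (lamG n) addrAC subrr add0r; apply: He => //.
by rewrite -[leLHS]fineK ?lee_fin// fin_num_measure.
Qed.

HB.instance Definition _ := isCharge.Build _ _ _ nu nu0 nu_fin nu_sigma_additive.

(** Absolute continuity upgrades finite to countable additivity: the remainders of
a disjoint union have measures that tend to 0. The Radon-Nikodym theorem then
applies. *)
Lemma additive_density : exists k : T -> R, mu.-integrable [set: T] (EFin \o k) /\
  forall A, measurable A -> lam A = \int[mu]_(t in A) k t.
Proof.
have numu : nu `<< mu.
  apply/null_content_dominatesP => A mA muA0; rewrite /nu; congr EFin.
  apply/eqP; rewrite -normr_le0; apply/ler_addgt0Pr => r r0; rewrite add0r.
  by have [e e0] := lam_ac r0; apply => //; rewrite muA0 lee_fin ltW.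
pose f := Radon_Nikodym nu mu.
have ff t : f t \is a fin_num by exact: Radon_Nikodym_fin_num.
have fE : EFin \o (fine \o f) = f by apply/funext => t /=; rewrite fineK.
exists (fine \o f); split; first by rewrite fE; exact: Radon_Nikodym_integrable.
move=> A mA.
have h : (lam A)%:E = (\int[mu]_(t in A) f t)%E := Radon_Nikodym_integral numu mA.
apply: etrans (congr1 fine h) _; congr fine.
by apply: eq_integral => t _ /=; rewrite fineK.
Qed.

End charge_of_additive.

Local Notation Loo := (fl_space (Linfty mu)).

Definition Linfty_indicator (A : set T) (mA : measurable A) : Loo :=
  @fl_of _ _ _ mu (Linfty mu) _ (Linfty_indic mu mA).

Lemma Linfty_indicatorE A (mA : measurable A) :
  {ae mu, forall t, Linfty_indicator mA t = \1_A t}.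
Proof. exact: fl_ofE. Qed.

Lemma Rintegral_indicator A (mA : measurable A) (k : T -> R) :
  mu.-integrable [set: T] (EFin \o k) ->
  \int[mu]_(t in [set: T]) (Linfty_indicator mA t * k t) = \int[mu]_(t in A) k t.
Proof.
move=> ik; have mk : measurable_fun [set: T] k.
  by apply/measurable_EFinP; exact: measurable_int ik.
rewrite [RHS]Rintegral_mkcond; congr fine; apply: ae_eq_integral => //.
- exact: measurable_int (Linfty_integrable (Linfty_indicator mA) ik).
- apply/measurable_EFinP; apply/(measurable_restrictT k mA).
  exact: measurable_funTS.
- apply: filterS (Linfty_indicatorE mA) => t -> _; rewrite patchE indicE.
  by case: (t \in A); rewrite ?mul1r ?mul0r.
Qed.

(** The layer-cake formula for the integer part of [y]. *)
Lemma sum_indicator_truncn (y : R) (N : nat) : 0 <= y -> y <= N%:R ->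
  \sum_(j < N) ((j.+1%:R <= y)%R%:R : R) = (Num.truncn y)%:R.
Proof.
move=> y0 yN; have tN : (Num.truncn y <= N)%N.
  by rewrite -(ler_nat R) (le_trans _ yN)//; have /andP[] := truncn_itv y0.
under eq_bigr do rewrite -truncn_gt_nat.
rewrite -natr_sum; congr (_%:R).
rewrite (eq_bigr (fun j : 'I_N => if (j < Num.truncn y)%N then 1%N else 0%N)); last first.
  by move=> j _; case: ifP.
rewrite -big_mkcond/= -(big_ord_widen N (fun=> 1%N) tN).
by rewrite sum1_card card_ord.
Qed.

(** Indicators span a dense subspace. Adding the constant [|u|] to [u] gives a
function [v] between 0 and [2 |u|]; the sum over [j < N] of the indicators of
the sets where [j + 1 <= n v] is the integer part of [n v], so that divided by
[n] it is within [1 / n] of [v] uniformly. *)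
Lemma Linfty_functional_eq0 (D : Loo -> R) (C : R) :
  (forall a u v, D (a *: u + v) = a * D u + D v) ->
  (forall u, `|D u| <= C * `|u|) ->
  (forall A (mA : measurable A), D (Linfty_indicator mA) = 0) ->
  forall u, D u = 0.
Proof.
move=> Dlin DC Dind u.
have D0 : D 0 = 0.
  have := Dlin 1 0 0; rewrite scale1r addr0 mul1r => /eqP.
  by rewrite -subr_eq subrr eq_sym => /eqP.
have DZ a w : D (a *: w) = a * D w by rewrite -[a *: w]addr0 Dlin D0 addr0.
have Dsum n (a : 'I_n -> R) (w : 'I_n -> Loo) :
    (forall j, D (w j) = 0) -> D (\sum_(j < n) a j *: w j) = 0.
  elim: n a w => [|n IH] a w w0; first by rewrite big_ord0.
  by rewrite big_ord_recr /= addrC Dlin w0 mulr0 add0r IH.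
pose v : Loo := `|u| *: Linfty_indicator measurableT + u.
have Dv : D v = D u by rewrite Dlin Dind mulr0 add0r.
have vE : {ae mu, forall t, v t = `|u| + u t}.
  apply: filterS2 (fl_linE `|u| (Linfty_indicator measurableT) u)
    (Linfty_indicatorE measurableT).
  by move=> t -> ->; rewrite indicT mulr1.
have mv := measurable_fl_repr v.
rewrite -Dv; apply/eqP; rewrite -normr_le0; apply/ler_addgt0Pr => e e0; rewrite add0r.
(* So that [C / n <= e]; [N] is large enough for [n v] to stay below it. *)
pose n := (Num.truncn (`|C| / e)).+1.
have n0 : 0 < n%:R :> R by [].
pose N := (Num.truncn (n%:R * (2 * `|u|))).+1.
pose A (j : nat) := [set t | j.+1%:R <= n%:R * v t].
have mA j : measurable (A j).
  rewrite (_ : A j = [set: T] `&` (fun t => n%:R * v t) @^-1` `[j.+1%:R, +oo[).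
    have mnv : measurable_fun [set: T] (fun t => n%:R * v t) by exact: measurable_funM.
    exact: mnv.
  by rewrite setTI; apply/seteqP; split => t /=; rewrite in_itv/= andbT.
pose w := \sum_(j < N) n%:R^-1 *: Linfty_indicator (mA j).
have Dw : D w = 0 by apply: Dsum => j; exact: Dind.
have wE : {ae mu, forall t, fl_repr w t = n%:R^-1 * \sum_(j < N) \1_(A j) t}.
  have jE : {ae mu, forall t, forall j : nat,
      fl_repr (n%:R^-1 *: Linfty_indicator (mA j)) t = n%:R^-1 * \1_(A j) t}.
    apply: ae_foralln => j.
    apply: filterS2 (fl_scaleE_ae n%:R^-1 (Linfty_indicator (mA j)))
      (Linfty_indicatorE (mA j)).
    by move=> t -> ->.
  apply: filterS2 (fl_sumE_ae (fun j : 'I_N => n%:R^-1 *: Linfty_indicator (mA j))) jE.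
  by move=> t -> h; rewrite mulr_sumr; apply: eq_bigr => j _.
have vw : `|v - w| <= n%:R^-1.
  apply: Linfty_norm_le; first by rewrite invr_ge0.
  apply: filterS3 (fl_subE_ae v w) wE (filterI vE (Linfty_ae_le u)) => t -> -> [vt ut].
  have v0 : 0 <= v t by rewrite vt -lerBlDl sub0r; move: ut; rewrite ler_norml => /andP[].
  have v2 : v t <= 2 * `|u|.
    by rewrite vt mulr_natl mulr2n lerD2l; move: ut; rewrite ler_norml => /andP[].
  have nv0 : 0 <= n%:R * v t by rewrite mulr_ge0.
  have nvN : n%:R * v t <= N%:R.
    by rewrite (le_trans _ (ltW (truncnS_gt _)))// ler_wpM2l.
  have -> : \sum_(j < N) (\1_(A j) t : R) = (Num.truncn (n%:R * v t))%:R.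
    rewrite -(sum_indicator_truncn nv0 nvN); apply: eq_bigr => j _.
    by rewrite indicE /A; congr (_%:R); congr nat_of_bool; apply/idP/idP; rewrite inE.
  have /andP[lo hi] := truncn_itv nv0; move: lo hi; rewrite -natr1.
  move: ((Num.truncn _)%:R : R) => r lo hi.
  rewrite -(ler_pM2l n0) mulfV ?gt_eqF// -{1}(ger0_norm (ltW n0)) -normrM mulrBr.
  by rewrite mulrA mulfV ?gt_eqF// mul1r ger0_norm ?subr_ge0// lerBlDl ltW.
have -> : D v = D (v - w).
  have := Dlin (-1) w v; rewrite scaleN1r Dw mulr0 add0r => <-.
  by rewrite addrC.
apply: (le_trans (DC _)); apply: (@le_trans _ _ (`|C| * n%:R^-1)).
  apply: (@le_trans _ _ (`|C| * `|v - w|)); first by rewrite ler_wpM2r// ler_norm.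
  by rewrite ler_wpM2l.
rewrite ler_pdivrMr// -ler_pdivrMl// mulrC ltW//.
exact: truncnS_gt.
Qed.

(** A density of the set function that [psi] induces on indicators represents
[psi] on indicators, hence everywhere by [Linfty_functional_eq0]. *)
Lemma Linfty_functional_density (psi : Loo -> R) (C : R) :
  (forall a u v, psi (a *: u + v) = a * psi u + psi v) ->
  (forall u, `|psi u| <= C * `|u|) ->
  (forall r : R, 0 < r -> exists2 e : R, 0 < e & forall A (mA : measurable A),
    (mu A <= e%:E)%E -> `|psi (Linfty_indicator mA)| <= r) ->
  exists k : T -> R, mu.-integrable [set: T] (EFin \o k) /\
    forall u, psi u = \int[mu]_(t in [set: T]) (u t * k t).
Proof.
move=> psi_lin psiC psi_ac.
pose lam (A : set T) : R :=
  if pselect (measurable A) is left mA then psi (Linfty_indicator mA) else 0.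
have lamE A (mA : measurable A) : lam A = psi (Linfty_indicator mA).
  rewrite /lam; case: pselect => // mA'; congr (psi (Linfty_indicator _)).
  exact: Prop_irrelevance.
have lam_add A B : measurable A -> measurable B -> A `&` B = set0 ->
    lam (A `|` B) = lam A + lam B.
  move=> mA mB AB; rewrite (lamE _ mA) (lamE _ mB) (lamE _ (measurableU _ _ mA mB)).
  rewrite -[psi (Linfty_indicator mA)]mul1r -psi_lin scale1r; congr psi.
  apply: fl_space_ext; apply: filterS3 (Linfty_indicatorE (measurableU _ _ mA mB))
    (fl_addE_ae (Linfty_indicator mA) (Linfty_indicator mB))
    (filterI (Linfty_indicatorE mA) (Linfty_indicatorE mB)) => t -> -> [-> ->].
  rewrite !indicE in_setU.
  case: (boolP (t \in A)) => tA; case: (boolP (t \in B)) => tB //=;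
    rewrite ?addr0 ?add0r//.
  by have : set0 t by rewrite -AB; split; exact: set_mem.
have lam_ac (r : R) : 0 < r -> exists2 e : R, 0 < e &
    forall A, measurable A -> (mu A <= e%:E)%E -> `|lam A| <= r.
  move=> r0; have [e e0 He] := psi_ac r r0; exists e => // A mA muA.
  by rewrite (lamE _ mA); exact: He.
have [k [ik kE]] := additive_density lam_add lam_ac.
exists k; split => // u; apply/eqP; rewrite -subr_eq0; apply/eqP.
have mk : measurable_fun [set: T] k.
  by apply/measurable_EFinP; exact: measurable_int ik.
have iuk (x : Loo) := Linfty_integrable x ik.
apply: (@Linfty_functional_eq0
  (fun u => psi u - \int[mu]_(t in [set: T]) (u t * k t))
  (C + \int[mu]_(t in [set: T]) `|k t|)).
- move=> a x y; rewrite psi_lin Rintegral_fl_linear//.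
  by rewrite opprD addrACA mulrBr.
- move=> x; rewrite (le_trans (ler_normB _ _))// mulrDl lerD//.
  rewrite (le_trans (le_normr_Rintegral _ (iuk x)))//.
  rewrite mulrC -RintegralZl//; last exact: integrable_norm ik.
  rewrite -lee_fin /Rintegral !fineK; last 2 first.
  + apply: integrable_fin_num => //.
    exact: (integrableZl measurableT `|x| (integrable_norm ik)).
  + by apply: integrable_fin_num => //; exact: (integrable_norm (iuk x)).
  apply: ae_ge0_le_integral => //.
  + apply/measurable_EFinP; apply: measurableT_comp => //; apply: measurable_funM => //.
    exact: measurable_fl_repr.
  + by apply/measurable_EFinP; apply: measurable_funM => //; exact: measurableT_comp.
  + by apply: filterS (Linfty_ae_le x) => t xt _; rewrite lee_fin normrM ler_wpM2r.
- by move=> A mA; rewrite Rintegral_indicator// -kE// -lamE subrr.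
Qed.

End densities.

(** * Weak compactness *)

Section weak_compactness.
Context (R : realType) (d : measure_display) (T : measurableType d).
Variables (mu : {finite_measure set T -> \bar R}) (p : exponent T R).
Local Notation Loo := (fl_space (Linfty mu)).
Local Notation Lp := (fl_space (variable_Lebesgue mu p)).
Local Notation i := (Linfty_embedding mu p).

(** On the set where [k > 1], the function [k - 1] is positive and its integral
is not. *)
Lemma ae_le1_of_averages (k : T -> R) : mu.-integrable [set: T] (EFin \o k) ->
  (forall A, measurable A -> \int[mu]_(t in A) k t <= fine (mu A)) ->
  {ae mu, forall t, k t <= 1}.
Proof.
move=> ik kA; have mk : measurable_fun [set: T] k.
  by apply/measurable_EFinP; exact: measurable_int ik.
pose A := [set t | 1 < k t].
have mA : measurable A.
  rewrite (_ : A = [set: T] `&` k @^-1` `]1, +oo[); first exact: mk.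
  by rewrite setTI; apply/seteqP; split => t /=; rewrite in_itv/= andbT.
have ikA : mu.-integrable A (EFin \o k) by exact: integrableS ik.
have i1A : mu.-integrable A (EFin \o cst 1) by exact: finite_measure_integrable_cst.
have mk1 : measurable_fun A (fun t => (k t - 1)%:E).
  by apply/measurable_EFinP/measurable_funTS; exact: measurable_funB.
have int0 : (\int[mu]_(t in A) `|(k t - 1)%:E| = 0)%E.
  apply/eqP; rewrite eq_le integral_ge0// andbT.
  have -> : (\int[mu]_(t in A) `|(k t - 1)%:E| =
      (\int[mu]_(t in A) k t - \int[mu]_(t in A) (cst 1 t))%:E)%E.
    rewrite -RintegralB// /Rintegral fineK; last first.
      exact: (integrable_fin_num mA (integrableB mA ikA i1A)).
    apply: eq_integral => t; rewrite inE => At.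
    by rewrite gee0_abs// lee_fin subr_ge0 ltW.
  by rewrite lee_fin Rintegral_cst// mul1r subr_le0 kA.
have := (ae_eq_integral_abs mu mA mk1).1 int0.
apply: filterS => t h; rewrite leNgt; apply/negP => kt.
have [] := h kt; move/eqP; rewrite subr_eq0 => /eqP k1.
by move: kt; rewrite k1 ltxx.
Qed.

Lemma ae_abs_le1_of_averages (k : T -> R) : mu.-integrable [set: T] (EFin \o k) ->
  (forall A, measurable A -> `|\int[mu]_(t in A) k t| <= fine (mu A)) ->
  {ae mu, forall t, `|k t| <= 1}.
Proof.
move=> ik kA; have mk : measurable_fun [set: T] k.
  by apply/measurable_EFinP; exact: measurable_int ik.
have iNk : mu.-integrable [set: T] (EFin \o (fun t => - k t)) by exact: integrableN ik.
have k1 := @ae_le1_of_averages k ik (fun A mA => le_trans (ler_norm _) (kA A mA)).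
have Nk1 : {ae mu, forall t, - k t <= 1}.
  apply: ae_le1_of_averages => // A mA.
  have -> : \int[mu]_(t in A) (- k t) = - \int[mu]_(t in A) k t.
    rewrite -[RHS]mulN1r -RintegralZl//; last exact: integrableS ik.
    by apply: eq_Rintegral => t _; rewrite mulN1r.
  by rewrite (le_trans (ler_norm _))// normrN kA.
by apply: filterS2 k1 Nk1 => t h1 h2; rewrite ler_norml lerNl h2.
Qed.

Import HBSimple.

(** On the unit ball of L^oo, weak-star convergence may be tested on bounded
functions only, because these are dense in L^1. *)
Lemma cvg_pairing I (U : set_system I) (f : I -> Loo) (g : Loo) (k : T -> R) :
  Filter U -> (forall j, `|f j| <= 1) -> `|g| <= 1 ->
  (forall u : Loo, \int[mu]_(t in [set: T]) (f j t * u t) @[j --> U] -->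
     (\int[mu]_(t in [set: T]) (g t * u t) : R)) ->
  mu.-integrable [set: T] (EFin \o k) ->
  \int[mu]_(t in [set: T]) (f j t * k t) @[j --> U] -->
     (\int[mu]_(t in [set: T]) (g t * k t) : R).
Proof.
move=> FU f1 g1 fg ik.
have mk : measurable_fun [set: T] k.
  by apply/measurable_EFinP; exact: measurable_int ik.
apply/cvgrPdist_le => e e0.
have e3 : 0 < e / 3 by rewrite divr_gt0.
have [S kS] : exists S : Loo, (\int[mu]_t `|(k t - S t)%:E| <= (e / 3)%:E)%E.
  have [s [_ _ /fine_cvgP[fin /cvgrPdist_le/(_ _ e3) sk]]] :=
    approximation_sfun_integrable measurableT ik.
  have [n _ /(_ n (leqnn _)) [finn skn]] := filterI fin sk.
  have ms : measurable_fun [set: T] (s n) by exact: measurable_funP.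
  have [M [_ Ms]] := simple_bounded (s n).
  have sM : Linfty_mem mu (s n).
    apply: (@Linfty_bounded _ _ _ mu _ (`|M| + 1) ms _ _).1 => //.
    apply: nearW => t; apply: Ms => //.
    by rewrite (le_lt_trans (ler_norm _))// ltrDl.
  exists (@fl_of _ _ _ mu (Linfty mu) _ sM); set S := fl_of _.
  have -> : (\int[mu]_t `|(k t - S t)%:E| = \int[mu]_t `|(k t)%:E - (s n t)%:E|)%E.
    apply: ae_eq_integral => //.
    - apply: measurableT_comp => //; apply/measurable_EFinP; apply: measurable_funB => //.
      exact: measurable_fl_repr.
    - by apply: measurableT_comp => //; apply/measurable_EFinP; exact: measurable_funB.
    - by apply: filterS (@fl_ofE _ _ _ mu (Linfty mu) _ sM) => t -> _.
  rewrite -[leLHS]fineK// lee_fin.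
  by move: skn; rewrite /= sub0r normrN ger0_norm// fine_ge0// integral_ge0.
have diff (h : Loo) : `|h| <= 1 ->
    `|\int[mu]_(t in [set: T]) (h t * k t) -
      \int[mu]_(t in [set: T]) (h t * S t)| <= e / 3.
  move=> h1; have ihk := Linfty_integrable h ik.
  have ihS := Linfty_integrable h (Linfty_integrable1 S).
  rewrite -RintegralB//.
  have ihD : mu.-integrable [set: T] (EFin \o (fun t => h t * k t - h t * S t)).
    exact: (integrableB measurableT ihk ihS).
  apply: (le_trans (le_normr_Rintegral measurableT ihD)).
  rewrite -lee_fin /Rintegral fineK; last first.
    by apply: integrable_fin_num => //; exact: (integrable_norm ihD).
  apply: le_trans kS; apply: ae_ge0_le_integral => //.
  - apply/measurable_EFinP; apply: measurableT_comp => //.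
    by apply/measurable_EFinP; exact: measurable_int ihD.
  - apply: measurableT_comp => //; apply/measurable_EFinP; apply: measurable_funB => //.
    exact: measurable_fl_repr.
  - apply: filterS (Linfty_ae_le h) => t ht _.
    by rewrite -mulrBr normrM lee_fin ler_piMl// (le_trans ht).
have /cvgrPdist_le/(_ _ e3) := fg S; apply: filterS => j fj.
have := diff g g1; have := diff (f j) (f1 j); move: fj.
rewrite !ler_norml => /andP[a1 a2] /andP[b1 b2] /andP[c1 c2].
by apply/andP; split; lra.
Qed.

Lemma weighted_one A (v : Lp) :
  weighted_integral 1 A v = \int[mu]_(t in A) v t.
Proof. by apply: eq_Rintegral => t _; rewrite powR1 mulr1. Qed.

Lemma exists_average_functional A : measurable A ->
  exists phi : dual Lp, forall v : Lp, sval phi v = \int[mu]_(t in A) v t.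
Proof.
move=> mA.
have IAy : (\int[mu]_(t in A) ((1 `^ p t)%R)%:E < +oo)%E.
  under eq_integral do rewrite powR1.
  by rewrite integral_cst// mul1e ltey_eq fin_num_measure.
have [phi phiE] := exists_dual (weighted_integral_linear ltr01 mA IAy)
  (weighted_integral_bounded ltr01 mA IAy).
by exists phi => v; rewrite phiE weighted_one.
Qed.

Lemma Lp_integrable (v : Lp) : mu.-integrable [set: T] (EFin \o v).
Proof.
have IAy : (\int[mu]_(t in [set: T]) ((1 `^ p t)%R)%:E < +oo)%E.
  under eq_integral do rewrite powR1.
  by rewrite integral_cst// mul1e ltey_eq fin_num_measure.
have := weighted_integrable ltr01 measurableT IAy v.
by apply: eq_integrable => // t _ /=; rewrite powR1 mulr1.
Qed.

(** Describes the image of the unit ball by inequalities between continuous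
functionals, so that it is weakly closed. *)
Lemma image_unit_ballP (x : Lp) :
  (i @` unit_ball Loo) x <->
  forall A, measurable A -> `|\int[mu]_(t in A) x t| <= fine (mu A).
Proof.
split=> [[u u1 <-] A mA|xA].
  have iu := integrableS measurableT mA (@subsetT _ _) (Lp_integrable (i u)).
  apply: (le_trans (le_normr_Rintegral mA iu)).
  rewrite -[fine (mu A)]mul1r -Rintegral_cst//.
  rewrite -lee_fin /Rintegral !fineK; last 2 first.
  - exact: (integrable_fin_num mA (finite_measure_integrable_cst mu 1 mA)).
  - exact: (integrable_fin_num mA (integrable_norm iu)).
  apply: ae_ge0_le_integral => //.
  - apply/measurable_EFinP/measurable_funTS; apply: measurableT_comp => //.
    exact: measurable_fl_repr.
  - apply: filterS2 (Linfty_embeddingE p u) (Linfty_ae_le u).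
    move=> t iut ut _; rewrite lee_fin [X in `|X|](_ : _ = fl_repr u t); last exact: iut.
    exact: le_trans u1.
have x1 := ae_abs_le1_of_averages (Lp_integrable x) xA.
have [xoo xn] := Linfty_bounded (measurable_fl_repr x) ler01 x1.
exists (@fl_of _ _ _ mu (Linfty mu) _ xoo).
  by rewrite /unit_ball /= norm_fl_of.
apply: fl_space_ext; apply: filterS2
  (Linfty_embeddingE p (@fl_of _ _ _ mu (Linfty mu) _ xoo))
  (@fl_ofE _ _ _ mu (Linfty mu) _ xoo) => t h1 h2.
by rewrite h1 h2.
Qed.

Lemma weakly_closed_image_unit_ball : closed (i @` unit_ball Loo : set (weak Lp)).
Proof.
move=> x clx; apply/image_unit_ballP => A mA.
have [phi phiE] := exists_average_functional mA.
rewrite -phiE leNgt; apply/negP => xA.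
have /cvg_weak/(_ phi) phix : nbhs (x : weak Lp) --> (x : weak Lp) by exact: cvg_id.
have h := cvgr_gt _ (cvg_norm phix) _ xA.
have [y [yB]] := clx _ (h _ _); rewrite phiE ltNge => /negP; apply.
by move/image_unit_ballP : yB => /(_ A mA).
Qed.

Lemma L2_product_le (u v : Loo) : `|u| <= 1 ->
  `|L2_product u v| <= \int[mu]_(t in [set: T]) `|v t|.
Proof.
move=> u1; have iuv := Linfty_integrable u (Linfty_integrable1 v).
have iv := Linfty_integrable1 v.
apply: (le_trans (le_normr_Rintegral measurableT iuv)).
rewrite -lee_fin /Rintegral !fineK; last 2 first.
- exact: (integrable_fin_num measurableT (integrable_norm iv)).
- exact: (integrable_fin_num measurableT (integrable_norm iuv)).
apply: ae_ge0_le_integral => //.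
- apply/measurable_EFinP; apply: measurableT_comp => //.
  by apply/measurable_EFinP; exact: measurable_int iuv.
- apply/measurable_EFinP; apply: measurableT_comp => //.
  exact: measurable_fl_repr.
- apply: filterS (Linfty_ae_le u) => t ut _.
  by rewrite lee_fin normrM ler_piMl// (le_trans ut).
Qed.

Lemma Rintegral_norm_le_indic (u : Loo) (A : set T) (c : R) :
  measurable A -> 0 <= c -> {ae mu, forall t, `|u t| <= c * \1_A t} ->
  \int[mu]_(t in [set: T]) `|u t| <= c * fine (mu A).
Proof.
move=> mA c0 uc; have iu := Linfty_integrable1 u.
have i1 := integrableZl measurableT c (integrable_indic mu mA).
have -> : c * fine (mu A) = \int[mu]_(t in [set: T]) (c * \1_A t).
  rewrite RintegralZl//; last exact: integrable_indic.
  by rewrite /Rintegral integral_indic// setIT.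
rewrite -lee_fin /Rintegral !fineK; last 2 first.
- exact: (integrable_fin_num measurableT i1).
- exact: (integrable_fin_num measurableT (integrable_norm iu)).
apply: ae_ge0_le_integral => //.
- apply/measurable_EFinP; apply: measurableT_comp => //.
  exact: measurable_fl_repr.
- by move=> t _; rewrite lee_fin mulr_ge0.
- by apply/measurable_EFinP; exact: measurable_funM.
- by apply: filterS uc => t h _; rewrite lee_fin.
Qed.

(** The Banach-Alaoglu theorem for the unit ball of L^oo as the dual of L^1. The
limits of the pairings define a functional [psi] with [|psi u|] at most the
integral of [|u|]; hence it has a density, whose averages are at most 1 in
absolute value. *)
Lemma ultrafilter_weak_star_limit I (U : set_system I) (f : I -> Loo) :
  UltraFilter U -> (forall y, `|f y| <= 1) ->
  exists2 g : Loo, `|g| <= 1 &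
    forall u : Loo, L2_product (f y) u @[y --> U] --> L2_product g u.
Proof.
move=> UU f1; have PU : ProperFilter U by exact: ultra_proper.
have /choice[psi psiP] (u : Loo) : exists l : R,
    L2_product (f y) u @[y --> U] --> l /\
    `|l| <= \int[mu]_(t in [set: T]) `|u t|.
  by apply: ultrafilter_bounded_cvg => y; exact: L2_product_le.
have psi_lin a u v : psi (a *: u + v) = a * psi u + psi v.
  have h : L2_product (f y) (a *: u + v) @[y --> U] --> a * psi u + psi v.
    rewrite (_ : (fun y => _) =
        (fun y => a * L2_product (f y) u + L2_product (f y) v)).
      apply: (@cvgD R R); last exact: (psiP v).1.
      by apply: (@cvgM R); [exact: cvg_cst|exact: (psiP u).1].
    apply/funext => y; rewrite L2_product_sym L2_product_linear.
    by rewrite ![L2_product _ (f y)]L2_product_sym.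
  exact: (@cvg_unique _ (@Rhausdorff R) _ _ _ _ (psiP _).1 h).
have psi_bounded u : `|psi u| <= fine (mu [set: T]) * `|u|.
  apply: (le_trans (psiP u).2); rewrite mulrC.
  apply: Rintegral_norm_le_indic => //.
  by apply: filterS (Linfty_ae_le u) => t; rewrite indicT mulr1.
have psi_indic A (mA : measurable A) :
    `|psi (Linfty_indicator mu mA)| <= fine (mu A).
  apply: (le_trans (psiP _).2); rewrite -[fine (mu A)]mul1r.
  apply: Rintegral_norm_le_indic => //.
  apply: filterS (Linfty_indicatorE mu mA) => t ->.
  by rewrite mul1r norm_indic.
have psi_ac (r : R) : 0 < r -> exists2 e : R, 0 < e &
    forall A (mA : measurable A),
    (mu A <= e%:E)%E -> `|psi (Linfty_indicator mu mA)| <= r.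
  move=> r0; exists r => // A mA muA; apply: (le_trans (psi_indic A mA)).
  by rewrite -lee_fin fineK// fin_num_measure.
have [g0 [ig0 g0E]] := Linfty_functional_density psi_lin psi_bounded psi_ac.
have g1 : {ae mu, forall t, `|g0 t| <= 1}.
  apply: ae_abs_le1_of_averages => // A mA.
  by rewrite -(Rintegral_indicator mA ig0) -g0E.
have mg0 : measurable_fun [set: T] g0.
  by apply/measurable_EFinP; exact: measurable_int ig0.
have [goo gn] := Linfty_bounded mg0 ler01 g1.
pose g : Loo := @fl_of _ _ _ mu (Linfty mu) _ goo.
have gE : {ae mu, forall t, g t = g0 t}.
  exact: (@fl_ofE _ _ _ mu (Linfty mu) _ goo).
exists g; first by rewrite norm_fl_of.
move=> u; rewrite (_ : L2_product g u = psi u); first exact: (psiP u).1.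
rewrite g0E; congr fine; apply: ae_eq_integral => //.
- exact: measurable_int (Linfty_integrable g (Linfty_integrable1 u)).
- exact: measurable_int (Linfty_integrable u ig0).
- by apply: filterS gE => t -> _; rewrite mulrC.
Qed.

(** Exponential integrability makes the norm of the indicator of a set small with
its measure, which is the absolute continuity that
[Linfty_functional_density] requires. *)
Lemma dual_density (phi : dual Lp) : exponentially_integrable mu p ->
  exists k : T -> R, mu.-integrable [set: T] (EFin \o k) /\
    forall u : Loo, sval phi (i u) = \int[mu]_(t in [set: T]) (u t * k t).
Proof.
move=> J; have [C phiC] := dual_bounded phi.
apply: (@Linfty_functional_density _ _ _ mu (fun u => sval phi (i u))
  (`|C| * luxemburg_norm mu p (cst 1))).
- by move=> a u v; rewrite linearP dual_linear.
- move=> u; apply: (le_trans (phiC _)); rewrite -mulrA.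
  apply: (@le_trans _ _ (`|C| * `|i u|)); first by rewrite ler_wpM2r// ler_norm.
  by rewrite ler_wpM2l// norm_Linfty_embedding_le.
- move=> r r0; have C1 : 0 < `|C| + 1 by rewrite ltr_wpDl.
  have [e e0 He] := small_norm_small_set J (divr_gt0 r0 C1).
  exists e => // A mA muA; apply: (le_trans (phiC _)).
  apply: (@le_trans _ _ ((`|C| + 1) * `|i (Linfty_indicator mu mA)|)).
    by rewrite ler_wpM2r// (le_trans (ler_norm _))// lerDl.
  rewrite -ler_pdivlMl// mulrC; apply: le_trans (He A mA muA).
  rewrite norm_Linfty_embedding; apply: luxemburg_normS.
  + exact: measurable_fl_repr.
  + by apply: Linfty_sub_variable_Lebesgue; exact: Linfty_indic.
  + by apply: filterS (Linfty_indicatorE mu mA) => t ->.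
Qed.

(** Lift an ultrafilter on the image of the unit ball to L^oo and take its
weak-star limit; since functionals of the variable Lebesgue space restrict to
integrals against integrable functions, the image of that limit is the weak
limit. *)
Lemma exponentially_integrable_weakly_compact :
  exponentially_integrable mu p -> weakly_compact i.
Proof.
move=> J; rewrite /weakly_compact precompact_closed; last first.
  exact: weakly_closed_image_unit_ball.
rewrite compact_ultra => U UU UB.
have PU : ProperFilter U by exact: ultra_proper.
have /choice[f fP] (y : Lp) : exists u : Loo, `|u| <= 1 /\
    ((i @` unit_ball Loo) y -> i u = y).
  have [[u u1 uy]|ny] := pselect ((i @` unit_ball Loo) y); first by exists u.
  by exists 0; rewrite normr0.
have [g g1 fg] := ultrafilter_weak_star_limit UU (fun y => (fP y).1).
exists (i g); split; first by exists g.
apply/cvg_weak => phi; have [k [ik kE]] := dual_density phi J.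
have lim : sval phi (i (f y)) @[y --> U] --> (sval phi (i g) : R).
  rewrite kE; under eq_fun do rewrite kE.
  by apply: cvg_pairing => // y; exact: (fP y).1.
apply: cvg_trans lim; apply: near_eq_cvg.
by apply: filterS UB => y yB; congr (sval phi _); exact/(fP y).2.
Qed.

End weak_compactness.

(** * The equivalence *)

Unset Implicit Arguments.

Theorem theorem4p4 (R : realType) (d : measure_display) (T : measurableType d)
    (mu : {finite_measure set T -> \bar R}) (p : exponent T R)
    (mu_atomless : atomless mu) :
  let i := Linfty_embedding mu p in
  [<-> (forall a : R, 1 < a ->
         (\int[lebesgue_measure]_(x in `]0%R, fine (mu [set: T])[)
            ((a `^ fine (rearrangement mu p x))%R)%:E < +oo)%E);
       (forall E : nat -> set T, (forall n, measurable (E n)) ->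
         {ae mu, forall t, (\1_(E n) t : R) @[n --> \oo] --> (0 : R)} ->
         luxemburg_norm mu p \1_(E n) @[n --> \oo] --> (0 : R));
       L_weakly_compact i;
       M_weakly_compact i;
       weakly_compact i;
       strictly_singular i;
       disjointly_strictly_singular i].
Proof.
move=> i; have eq1 := exponentially_integrable_rearrangement mu p.
tfae.
- by move=> /eq1; exact: exponentially_integrable_order_continuous.
- exact: order_continuous_L_weakly_compact.
- exact: L_weakly_compact_M_weakly_compact.
- move=> /M_weakly_compact_exponentially_integrable.
  exact: exponentially_integrable_weakly_compact.
- move=> /weakly_compact_exponentially_integrable.
  exact: exponentially_integrable_strictly_singular.
- exact: strictly_singular_disjointly.
- by move=> /disjointly_strictly_singular_exponentially_integrable /eq1.
Qed.
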